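(* Let $\pi\colon(T,X)\to(T,Y)$ be an extension of minimal compact dynamics which is not PI. Then $(T,\mathtt M_\infty)$ is an M-dynamic contained in $\mathtt R_\pi$, with $\Delta_X\subsetneq\mathtt M_\infty$ and $\mathtt{RP}_{\pi|\mathtt M_\infty}=\mathtt M_\infty$.
   Context: $T$ is a group or monoid acting continuously, regarded as discrete. An extension is a continuous equivariant surjection. $\mathtt R_\pi=\{(x_1,x_2):\pi x_1=\pi x_2\}$ with diagonal action; $\Delta_X$ is the diagonal. A point is a.p. if its return times to each neighborhood form a syndetic set (there is a finite $K$ with $Kt\cap A\ne\emptyset$ for all $t$). A dynamic is T.T. if $\{t: V\cap tU\ne\emptyset\}\neq\emptyset$ for all nonempty open $U,V$; it is an M-dynamic if T.T. with a dense set of a.p. points. For $L\subseteq\mathtt R_\pi$, $\mathtt{RP}_{\pi|L}$ is the set of $\tilde x\in L$ for which there are nets $\tilde x_j\in L$, $t_j\in T$ and $\tilde x'\in\Delta_X$ with $\tilde x_j\to\tilde x$, $t_j\tilde x_j\to\tilde x'$. Extension $\pi$ is proximal if $\overline{Tz}\cap\Delta_X\ne\emptyset$ for all $z\in\mathtt R_\pi$; it is a.p. if there is no $(x,x')\in\mathtt R_\pi\setminus\Delta_X$ such that $\overline{T((U\times V)\cap\mathtt R_\pi)}\cap\Delta_X\ne\emptyset$ for all neighborhoods $U$ of $x$, $V$ of $x'$. $\pi$ is PI if there are a minimal compact dynamic $X'$ and a proximal extension $\rho\colon X'\to X$ such that $\pi'=\pi\circ\rho$ admits a PI-tower: an ordinal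 $\vartheta$, minimal compact dynamics $Y_\gamma$ ($\gamma\le\vartheta$) with $Y_0=Y$, extensions $\pi'_\gamma\colon X'\to Y_\gamma$ ($\pi'_0=\pi'$) and $\psi_\gamma^{\gamma+1}\colon Y_{\gamma+1}\to Y_\gamma$ compatible with the $\pi'_\gamma$, each $\psi_\gamma^{\gamma+1}$ proximal or a.p., $Y_\gamma=\varprojlim_{\lambda<\gamma}Y_\lambda$ for limit $\gamma$, and $\pi'_\vartheta$ an isomorphism. Ellis machinery: let $\mathbb I$ be a minimal left ideal of $\beta T$, $(T,\mathbb I)$ the universal minimal dynamic, $\mathrm{Aut}(\mathbb I)$ its automorphism group, and $\Gamma[\alpha]=\{(m,\alpha m):m\in\mathbb I\}$. The $\tau$-topology: $\alpha_i\to_\tau\alpha$ iff for every $m\in\mathbb I$ there is a net $m_i\to m$ with $\alpha_im_i\to\alpha m$. For a $\tau$-closed subgroup $\mathbb F$, its derived group is $\mathbb F'=\{\alpha\in\mathbb F:\exists\delta_i\in\mathbb F,\ \delta_i\to_\tau\alpha,\ \delta_i\to_\tau\mathrm{id}_{\mathbb I}\}$. Fix an extension $\pi_X\colon\mathbb I\to X$ and put $\pi_Y=\pi\circ\pi_X$, $\mathbb F=\{\alpha:\pi_Y\circ\alpha=\pi_Y\}$. Set $\mathbb F_0=\mathbb F$, $\mathbb F_{o+1}=\mathbb F_o'$, $\mathbb F_o=\bigcap_{\gamma<o}\mathbb F_\gamma$ for limit $o$; $\mathbb F_\infty$ is the stable value of this transfinite sequence. Finally $\mathtt M_\infty=(\pi_X\times\pi_X)\big(\overline{\bigcup_{\alpha\in\mathbb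 F_\infty}\Gamma[\alpha]}\big)$. *)

(* Defs.v *)
From HB Require Import structures.
From mathcomp Require Import all_boot.
From mathcomp Require Import boolp classical_sets functions cardinality topology.
Set Implicit Arguments. Unset Strict Implicit. Unset Printing Implicit Defensive.
Local Open Scope classical_set_scope.

Record monoid := Monoid {
  mcar :> Type;
  mmul : mcar -> mcar -> mcar;
  mone : mcar;
  mmulA : forall a b c, mmul a (mmul b c) = mmul (mmul a b) c;
  mmul1 : forall a, mmul mone a = a;
  mmulm1 : forall a, mmul a mone = a }.

Definition directed (D : Type) (le : D -> D -> Prop) :=
  [/\ inhabited D, (forall i, le i i),
      (forall i j k, le i j -> le j k -> le i k) &
      (forall i j, exists k, le i k /\ le j k)].

Definition net_to (D : Type) (le : D -> D -> Prop) (X : topologicalType)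
  (x : D -> X) (l : X) :=
  forall U, nbhs l U -> exists i0, forall i, le i0 i -> U (x i).

Section Dynamics.
Variable T : monoid.

(** T acts continuously (T regarded as discrete). *)
Definition is_action (X : topologicalType) (a : T -> X -> X) :=
  [/\ (forall t, continuous (a t)), (forall x, a (mone T) x = x) &
      (forall s t x, a (mmul s t) x = a s (a t x))].

Definition compact_dynamic (X : topologicalType) (a : T -> X -> X) :=
  [/\ compact [set: X], hausdorff_space X & is_action a].

Definition invariant (X : topologicalType) (a : T -> X -> X) (A : set X) :=
  forall t x, A x -> A (a t x).

Definition minimal (X : topologicalType) (a : T -> X -> X) :=
  [set: X] !=set0 /\
  forall A : set X, closed A -> A !=set0 -> invariant a A -> A = [set: X].

Definition pact (X : topologicalType) (a : T -> X -> X) (t : T) (z : X * X) : X * X :=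
  (a t z.1, a t z.2).

Definition Rel (X Y : Type) (pi : X -> Y) : set (X * X) :=
  [set z | pi z.1 = pi z.2].

Definition Delta (X : Type) : set (X * X) := [set z | z.1 = z.2].
Arguments Delta X : clear implicits.


Definition extension (X Y : topologicalType) (aX : T -> X -> X) (aY : T -> Y -> Y)
  (pi : X -> Y) :=
  [/\ continuous pi, (forall t x, pi (aX t x) = aY t (pi x)) &
      (forall y, exists x, pi x = y)].

Definition dyn_iso (X Y : topologicalType) (aX : T -> X -> X) (aY : T -> Y -> Y)
  (f : X -> Y) :=
  extension aX aY f /\
  exists g : Y -> X, [/\ continuous g, cancel f g & cancel g f].

Definition proximal_ext (X Y : topologicalType) (aX : T -> X -> X) (pi : X -> Y) :=
  forall z, Rel pi z ->
    closure (range (fun t => pact aX t z)) `&` Delta X !=set0.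

Definition Tset (X : topologicalType) (aX : T -> X -> X) (S : set (X * X)) :=
  \bigcup_(t in [set: T]) (pact aX t @` S).

Definition ap_ext (X Y : topologicalType) (aX : T -> X -> X) (pi : X -> Y) :=
  ~ exists x x' : X, [/\ Rel pi (x, x'), x <> x' &
      forall U V, nbhs x U -> nbhs x' V ->
        closure (Tset aX ((U `*` V) `&` Rel pi)) `&` Delta X !=set0].

Definition well_order (O : Type) (lt : O -> O -> Prop) :=
  [/\ (forall x y z, lt x y -> lt y z -> lt x z), (forall x, ~ lt x x),
      (forall x y, [\/ x = y, lt x y | lt y x]) & well_founded lt].

Definition oleq (O : Type) (lt : O -> O -> Prop) (x y : O) := x = y \/ lt x y.

Definition is_succ (O : Type) (lt : O -> O -> Prop) (g g' : O) :=
  lt g g' /\ forall m, lt g m -> ~ lt m g'.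

Definition is_limit (O : Type) (lt : O -> O -> Prop) (g : O) :=
  (exists l, lt l g) /\ forall l, lt l g -> exists m, lt l m /\ lt m g.

(** A PI-tower for pi' : X' -> Y.  The tower is indexed by a well-ordered type
    O with least element bot (= 0) and greatest element top (= vartheta),
    i.e. O is the ordinal vartheta + 1.  psi l m : Y_m -> Y_l are the bonding
    maps (for l <= m), compatible with the pi'_g. *)
Definition PI_tower (X' Y : topologicalType) (aX' : T -> X' -> X') (aY : T -> Y -> Y)
  (pi' : X' -> Y) :=
  exists (O : Type) (lt : O -> O -> Prop) (bot top : O),
  [/\ well_order lt, (forall g, oleq lt bot g), (forall g, oleq lt g top) &
  exists (Yf : O -> topologicalType) (ay : forall g, T -> Yf g -> Yf g)
         (p : forall g, X' -> Yf g) (psi : forall l m, Yf m -> Yf l),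
  [/\ (forall g, compact_dynamic (ay g) /\ minimal (ay g)),
      (forall g, extension aX' (ay g) (p g)) &
      (forall l m, oleq lt l m ->
         extension (ay m) (ay l) (psi l m) /\ forall x, psi l m (p m x) = p l x)] /\
  [/\ (forall g g', is_succ lt g g' ->
         proximal_ext (ay g') (psi g g') \/ ap_ext (ay g') (psi g g')),
      (forall g, is_limit lt g ->
         (forall y1 y2 : Yf g,
            (forall l, lt l g -> psi l g y1 = psi l g y2) -> y1 = y2) /\
         (forall z : forall l, Yf l,
            (forall l m, oleq lt l m -> lt m g -> psi l m (z m) = z l) ->
            exists y, forall l, lt l g -> psi l g y = z l)),
      (exists h : Yf bot -> Y,
         dyn_iso (ay bot) aY h /\ forall x, h (p bot x) = pi' x) &
      dyn_iso aX' (ay top) (p top)]].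

Definition PI (X Y : topologicalType) (aX : T -> X -> X) (aY : T -> Y -> Y)
  (pi : X -> Y) :=
  exists (X' : topologicalType) (aX' : T -> X' -> X') (rho : X' -> X),
  [/\ compact_dynamic aX', minimal aX', extension aX' aX rho,
      proximal_ext aX' rho & PI_tower aX' aY (pi \o rho)].

Definition syndetic (A : set T) :=
  exists K : set T, finite_set K /\ forall t, exists2 k, K k & A (mmul k t).

Definition ap_point (X : topologicalType) (a : T -> X -> X) (x : X) :=
  forall U, nbhs x U -> syndetic [set t | U (a t x)].

Definition M_dynamic_in (X : topologicalType) (a : T -> X -> X) (L : set (X * X)) :=
  [/\ invariant (pact a) L,
      (forall U V : set (X * X), open U -> open V ->
         U `&` L !=set0 -> V `&` L !=set0 ->
         exists t, V `&` L `&` (pact a t @` (U `&` L)) !=set0) &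
      (forall U : set (X * X), open U -> U `&` L !=set0 ->
         exists2 z, (U `&` L) z & ap_point (pact a) z)].

Definition RP_in (X : topologicalType) (a : T -> X -> X) (L : set (X * X)) :
  set (X * X) :=
  [set z | L z /\
    exists (D : Type) (le : D -> D -> Prop) (zs : D -> X * X) (ts : D -> T)
           (z' : X * X),
      [/\ directed le, (forall i, L (zs i)), Delta X z', net_to le zs z &
          net_to le (fun i => pact a (ts i) (zs i)) z']].

Definition universal_minimal (I : topologicalType) (aI : T -> I -> I) :=
  [/\ compact_dynamic aI, minimal aI &
      forall (Z : topologicalType) (aZ : T -> Z -> Z),
        compact_dynamic aZ -> minimal aZ -> exists f : I -> Z, extension aI aZ f].

Section Ellis.
Variables (I : topologicalType) (aI : T -> I -> I).

Definition is_aut (al : I -> I) := dyn_iso aI aI al.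

Definition tau_to (D : Type) (le : D -> D -> Prop) (al : D -> I -> I) (a : I -> I) :=
  forall m : I, exists mi : D -> I,
    net_to le mi m /\ net_to le (fun i => al i (mi i)) (a m).

Definition derived (G : set (I -> I)) : set (I -> I) :=
  [set a | G a /\
    exists (D : Type) (le : D -> D -> Prop) (d : D -> I -> I),
      [/\ directed le, (forall i, G (d i)), tau_to le d a & tau_to le d id]].

(** The stages F_o of the transfinite derived sequence starting at F0: they
    are generated by F0, derived groups, and intersections of (nonempty)
    families of stages (limit steps). *)
Inductive stage (F0 : set (I -> I)) : set (I -> I) -> Prop :=
  | stage_base : stage F0 F0
  | stage_succ G : stage F0 G -> stage F0 (derived G)
  | stage_lim (S : set (set (I -> I))) :
      S !=set0 -> (forall G, S G -> stage F0 G) -> stage F0 (\bigcap_(G in S) G).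

(** F_infty = the stable value = the intersection of all stages *)
Definition Finf (F0 : set (I -> I)) : set (I -> I) :=
  \bigcap_(G in stage F0) G.

Definition Gamma (al : I -> I) : set (I * I) := range (fun m => (m, al m)).

Variables (X Y : topologicalType) (pi : X -> Y) (piX : I -> X).

Definition Fgrp : set (I -> I) :=
  [set al | is_aut al /\ forall m, pi (piX (al m)) = pi (piX m)].

Definition Minf : set (X * X) :=
  (fun z : I * I => (piX z.1, piX z.2)) @`
    closure (\bigcup_(al in Finf Fgrp) Gamma al).

End Ellis.
End Dynamics.
Arguments Delta X : clear implicits.

(* Main.v *)
Require Import Defs.
From HB Require Import structures.
From Stdlib Require List.
From mathcomp Require Import all_boot.
From mathcomp Require Import boolp classical_sets functions cardinality topology.
Import Defs.
Set Implicit Arguments. Unset Strict Implicit. Unset Printing Implicit Defensive.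
Local Open Scope classical_set_scope.

(* Universality of [I] yields its coalescence (every endomorphism is invertible,
   via an Ellis semigroup structure on [I]), so every nonempty closed invariant
   subset of [I * I] contains the graph of an automorphism.  Hence [Finf] is a
   group equal to its own derived group, and any two of its elements are
   tau-inseparable; this is topological transitivity of [Minf], from which
   [RP = Minf] follows.

   If [Minf] were the diagonal, [Finf F] would be contained in the group [H] of
   [X].  Write [L K] for the closure of the union of the graphs of the elements of
   a group [K] of automorphisms.  Universality applied to a symbolic flow shows
   that [L K] is open as a relation, hence an invariant closed equivalence
   relation.  Put [X' = I / L H]; it is a proximal extension of [X].  Let [E]
   strictly contain [L H], with group [K].  If [E <> L K], then [I / L K -> I / E]
   is proximal.  If [E = L K], then [H K'] is a proper tau-closed subgroup of [K]
   (otherwise a minimal tau-closed [A] with [H A = K] is irreducible, so it lies in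
   a single coset of [Finf F]), and the pairs of [L K] whose orbit closure contains
   the graph of an element of [H K'] form a smaller relation giving an almost
   periodic extension.  Iterating transfinitely down to [L H] is a PI-tower. *)

(** * Minimal sets and the universal property *)

(** Zorn's lemma for unions of chains, applied to the sets [B] such that [P] holds of the complement
    of [B] in [A0]: a maximal [B] has a minimal complement. The empty chain corresponds to [A0]
    itself, so the chains in the hypothesis may be taken nonempty. *)
Lemma zorn_min (X : Type) (P : set (set X)) (A0 : set X) :
  P A0 ->
  (forall C : set (set X), C !=set0 -> C `<=` P ->
     total_on C subset -> P (\bigcap_(A in C) A)) ->
  exists A, [/\ P A, A `<=` A0 & forall B, P B -> B `<=` A -> B = A].
Proof.
move=> PA0 HP.
have [F FP Ftot|B [PB maxB]] := @Zorn_bigcup X [set B | P (A0 `\` B)].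
  have [->|/set0P F0] := eqVneq F set0; first by rewrite bigcup_set0 /= setD0.
  rewrite /=; have -> : A0 `\` \bigcup_(Z in F) Z =
      \bigcap_(A in [set A0 `\` Z | Z in F]) A.
    apply/seteqP; split=> [x [A0x Fx] _ [Z FZ <-]|x Fx].
      by split=> // Zx; apply: Fx; exists Z.
    have [Z FZ] := F0; split; first by case: (Fx _ (imageP _ FZ)).
    by move=> [W FW Wx]; case: (Fx _ (imageP _ FW)).
  apply: HP => [|_ [Z FZ <-]|_ _ [Z FZ <-] [W FW <-]].
  - by have [Z FZ] := F0; exists (A0 `\` Z); exists Z.
  - exact: FP.
  - by case: (Ftot _ _ FZ FW) => ZW; [right|left]=> x [? Nx]; split=> // /ZW.
exists (A0 `\` B); split=> [//|x []//|].
move=> C PC CA; apply: contrapT => CneA.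
apply: (maxB (B `|` (A0 `\` C))).
  split=> [x|sub]; first by left.
  apply: CneA; apply/seteqP; split=> // x [A0x Bx].
  by apply: contrapT => Cx; apply: Bx; apply: sub; right.
rewrite /=; suff -> : A0 `\` (B `|` A0 `\` C) = C by [].
apply/seteqP; split=> [x [A0x Hx]|x Cx].
  by apply: contrapT => Cx; apply: Hx; right.
by have [A0x Bx] := CA _ Cx; split=> // -[//|[]].
Qed.

Lemma compact_bigcap (X : topologicalType) (C : set (set X)) :
  compact [set: X] -> C !=set0 ->
  (forall A, C A -> closed A /\ A !=set0) ->
  (forall A B, C A -> C B -> exists2 D, C D & D `<=` A `&` B) ->
  \bigcap_(A in C) A !=set0.
Proof.
move=> cX C0 CC Cdir.
pose F := filter_from C id.
have FF : ProperFilter F.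
  apply: filter_from_proper; last by move=> A /CC[].
  by apply: filter_from_filter.
have [p [_]] := cX F FF filterT.
rewrite clusterE => clp; exists p => A CA.
have [clA _] := CC _ CA; apply: clA; apply: clp; by exists A.
Qed.

Lemma total_dir (X : Type) (C : set (set X)) : total_on C subset ->
  forall A B, C A -> C B -> exists2 D, C D & D `<=` A `&` B.
Proof.
move=> Ct A B CA CB; case: (Ct _ _ CA CB) => s.
  by exists A => // x Ax; split=> //; exact: s.
by exists B => // x Bx; split=> //; exact: s.
Qed.

Section Subtype.
Context (Z : topologicalType) (M : set Z).

Lemma subtype_val_continuous : continuous (set_val : M -> Z).
Proof. exact: initial_continuous. Qed.

Lemma to_subtype_continuous (W : topologicalType) (f : W -> M) :
  continuous (set_val \o f) -> continuous f.
Proof.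
move=> cf; apply/continuousP => _ [B oB <-].
exact: (open_comp _ oB (f := set_val \o f)).
Qed.

Lemma subtype_compact : compact [set: Z] -> closed M -> compact [set: M].
Proof.
move=> cZ clM F FF _.
have [z [_ clz]] := cZ (set_val @ F) (fmap_proper_filter _ FF) filterT.
have {}clz : forall A, (set_val @ F) A -> closure A z.
  by move=> A FA B nB; exact: clz.
have Mz : M z.
  apply: clM; apply: clz; apply: (@filterS _ F _ setT); last exact: filterT.
  by move=> [x xM] _; exact: set_mem.
exists (exist _ z (mem_set Mz)); split=> // A V FA.
rewrite nbhsE => -[_ [[B oB <-] /= Bz] sBV].
have /clz/(_ B) : (set_val @ F) (set_val @` A).
  by apply: (@filterS _ F _ A) => // x Ax; exists x.
case; first exact: open_nbhs_nbhs.
by move=> _ [[x Ax <-] Bx]; exists x; split=> //; apply: sBV.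
Qed.

Lemma subtype_hausdorff : hausdorff_space Z -> hausdorff_space M.
Proof.
move=> hZ x y clxy; apply: val_inj; apply: hZ => A B nA nB.
have [w []] := clxy _ _ (subtype_val_continuous nA) (subtype_val_continuous nB).
by exists (set_val w).
Qed.

End Subtype.

Section Dyn.
Context (T : monoid).

Definition equivariant (Z W : topologicalType) (aZ : T -> Z -> Z)
  (aW : T -> W -> W) (f : Z -> W) := forall t z, f (aZ t z) = aW t (f z).

Definition hom (Z W : topologicalType) (aZ : T -> Z -> Z)
  (aW : T -> W -> W) (f : Z -> W) := continuous f /\ equivariant aZ aW f.

Lemma closure_invariant (Z : topologicalType) (a : T -> Z -> Z) (A : set Z) :
  (forall t, continuous (a t)) -> invariant a A -> invariant a (closure A).
Proof.
move=> ca iA t x clx B nB.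
have [y [Ay By]] := clx _ (ca t x _ nB).
by exists (a t y); split=> //; exact: iA.
Qed.

Lemma orbit_invariant (Z : topologicalType) (a : T -> Z -> Z) (z : Z) :
  is_action a -> invariant a (range (fun t => a t z)).
Proof. by move=> [_ _ am] t _ [s _ <-]; exists (mmul t s) => //; rewrite am. Qed.

Lemma orbit_closure_refl (Z : topologicalType) (a : T -> Z -> Z) (z : Z) :
  is_action a -> closure (range (fun t => a t z)) z.
Proof. by move=> [_ a1 _]; apply: subset_closure; exists (mone T). Qed.

Lemma orbit_closure_sub (Z : topologicalType) (a : T -> Z -> Z) (z : Z) A :
  closed A -> invariant a A -> A z -> closure (range (fun t => a t z)) `<=` A.
Proof.
move=> clA iA Az; rewrite closureE => w; apply; split=> // _ [t _ <-].
exact: iA.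
Qed.

Lemma exists_minimal_set (Z : topologicalType) (a : T -> Z -> Z) (M : set Z) :
  compact [set: Z] -> closed M -> M !=set0 -> invariant a M ->
  exists A, [/\ closed A, A !=set0, invariant a A, A `<=` M &
    forall B, closed B -> B !=set0 -> invariant a B -> B `<=` A -> B = A].
Proof.
move=> cZ clM M0 iM.
pose P : set (set Z) := [set A | [/\ closed A, A !=set0 & invariant a A]].
have [//|C C0 CP Ct|A [[clA A0 iA] AM mA]] := @zorn_min Z P M.
  split.
  - by apply: closed_bigI => A /CP[].
  - by apply: compact_bigcap => //; [move=> A /CP[]|exact: total_dir].
  - by move=> t x Cx A CA; have [_ _ iA] := CP _ CA; apply: iA; exact: Cx.
by exists A; split=> // B clB B0 iB; exact: mA.
Qed.

Lemma minimal_dense_orbit (Z : topologicalType) (a : T -> Z -> Z) z (U : set Z) :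
  is_action a -> minimal a -> open U -> U !=set0 -> exists t, U (a t z).
Proof.
move=> act [_ mZ] oU [u Uu].
have ca : forall t, continuous (a t) by case: act.
have cE := mZ (closure (range (fun t => a t z))) (@closed_closure _ _)
  (ex_intro _ z (orbit_closure_refl act))
  (closure_invariant ca (orbit_invariant act)).
have : closure (range (fun t => a t z)) u by rewrite cE.
by move=> /(_ U (open_nbhs_nbhs (conj oU Uu))) [_ [[t _ <-] ?]]; exists t.
Qed.

(** A minimal subset of [M], seen as a subtype with the restricted action, is a minimal compact
    dynamic to which universality applies. This makes universality usable in dynamics that are not
    minimal, such as products. *)
Lemma universal_hom (I : topologicalType) (aI : T -> I -> I)
  (Z : topologicalType) (aZ : T -> Z -> Z) (M : set Z) :
  universal_minimal aI -> compact_dynamic aZ ->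
  closed M -> M !=set0 -> invariant aZ M ->
  exists f, hom aI aZ f /\ forall m, M (f m).
Proof.
move=> [_ _ univ] [cZ hZ [ca a1 am]] clM M0 iM.
have [A [clA A0 iA AM mA]] := exists_minimal_set cZ clM M0 iM.
have Aval (x : A) : A (set_val x) by exact: set_mem (svalP x).
pose aA (t : T) (x : A) : A := exist _ (aZ t (set_val x)) (mem_set (iA t _ (Aval x))).
have valA t x : set_val (aA t x) = aZ t (set_val x) by [].
have dA : compact_dynamic aA.
  split; [exact: subtype_compact|exact: subtype_hausdorff|split].
  - move=> t; apply: to_subtype_continuous.
    have -> : set_val \o aA t = aZ t \o set_val by [].
    move=> x; apply: continuous_comp; first exact: subtype_val_continuous.
    exact: ca.
  - by move=> x; apply: val_inj; rewrite /= a1.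
  - by move=> s t x; apply: val_inj; rewrite /= am.
have mAA : minimal aA.
  split; first by have [x Ax] := A0; exists (exist _ x (mem_set Ax)).
  move=> B clB [b Bb] iB.
  (* By compactness the image of [B] is closed in [Z], so minimality of [A] among the closed
     invariant sets of [Z] carries over to the subtype. *)
  have BA : set_val @` B = A.
    apply: mA.
    - apply: compact_closed => //.
      apply: continuous_compact.
        by apply: continuous_subspaceT; exact: subtype_val_continuous.
      exact: (subclosed_compact clB (subtype_compact cZ clA)).
    - by exists (set_val b); exists b.
    - move=> t _ [x Bx <-]; exists (aA t x) => //; exact: iB.
    - by move=> _ [x Bx <-].
  apply/seteqP; split=> // x _.
  have : (set_val @` B) (set_val x) by rewrite BA.
  by move=> [y By /val_inj <-].
have [f [cf ef _]] := univ _ _ dA mAA.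
exists (set_val \o f); split; last by move=> m; apply: AM; exact: Aval.
split; last by move=> t x /=; rewrite ef.
move=> x; apply: continuous_comp; first exact: cf.
exact: subtype_val_continuous.
Qed.

End Dyn.

(** * Coalescence of the universal minimal dynamic *)

Lemma continuous_compose (A B C : topologicalType) (f : A -> B) (g : B -> C) :
  continuous f -> continuous g -> continuous (g \o f).
Proof. by move=> cf cg x; apply: continuous_comp; [exact: cf|exact: cg]. Qed.

Lemma fst_continuous (A B : topologicalType) : continuous (@fst A B).
Proof. by move=> x; exact: cvg_fst. Qed.

Lemma snd_continuous (A B : topologicalType) : continuous (@snd A B).
Proof. by move=> x; exact: cvg_snd. Qed.

Lemma closed_equalizer (W V : topologicalType) (f g : W -> V) :
  hausdorff_space V -> continuous f -> continuous g ->
  closed [set x | f x = g x].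
Proof.
move=> hV cf cg x clx; apply: hV => A B nA nB.
have nfA : nbhs x (f @^-1` A) := cf x A nA.
have ngB : nbhs x (g @^-1` B) := cg x B nB.
have [y [/= fg [Ay By]]] := clx _ (filterI nfA ngB).
by exists (f y); split=> //; rewrite fg.
Qed.

Lemma ptws_continuous (W V : topologicalType) (U : Type) (f : W -> {ptws U -> V}) :
  (forall u, continuous (fun w => f w u)) -> continuous f.
Proof.
move=> cf w; apply/cvg_sup => u A.
rewrite nbhsE => -[_ [[B oB <-] /= Bw] sBA].
apply: filterS sBA _; apply: cf; exact: open_nbhs_nbhs.
Qed.

Lemma ptws_proj_continuous (V : topologicalType) (U : eqType) (u : U) :
  continuous (fun w : {ptws U -> V} => w u).
Proof. exact: (@proj_continuous U (fun=> V) u). Qed.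

Lemma ptws_compact (U : eqType) (V : topologicalType) :
  compact [set: V] -> compact [set: {ptws U -> V}].
Proof.
move=> cV; have := @tychonoff U (fun=> V) (fun=> setT) (fun=> cV).
by congr compact; apply/seteqP; split.
Qed.

(** Take a minimal closed subsemigroup [A] and [u] in it. Then [A u] is a closed subsemigroup, so it
    equals [A] and contains [u]; hence the [x] in [A] with [op x u = u] form a nonempty closed
    subsemigroup, which is again [A] and contains [u]. *)
Lemma ellis_numakura (I : topologicalType) (op : I -> I -> I) (S : set I) :
  compact [set: I] -> hausdorff_space I ->
  (forall x, continuous (op^~ x)) -> associative op ->
  closed S -> S !=set0 -> (forall x y, S x -> S y -> S (op x y)) ->
  exists2 u, S u & op u u = u.
Proof.
move=> cI hI opc opA clS S0 Sop.
pose P : set (set I) := [set A | [/\ closed A, A !=set0 &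
  forall x y, A x -> A y -> A (op x y)]].
have cpt (A : set I) : closed A -> compact A.
  by move=> clA; exact: subclosed_compact clA cI (@subsetT _ _).
have [//|C C0 CP Ct|A [[clA [u Au] Aop] AS mA]] := @zorn_min I P S.
  split.
  - by apply: closed_bigI => A /CP[].
  - by apply: compact_bigcap => //; [move=> A /CP[]|exact: total_dir].
  - move=> x y Cx Cy A CA; have [_ _ oA] := CP _ CA.
    by apply: oA; [exact: Cx|exact: Cy].
exists u; first exact: AS.
have AuA : [set op x u | x in A] = A.
  apply: mA; last by move=> _ [x Ax <-]; exact: Aop.
  split.
  - apply: compact_closed => //; apply: continuous_compact; last exact: cpt.
    by apply: continuous_subspaceT; exact: opc.
  - by exists (op u u); exists u.
  - move=> _ _ [x Ax <-] [y Ay <-]; exists (op (op x u) y) => //.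
    by apply: (Aop _ _ _ Ay); exact: Aop.
have BA : A `&` [set x | op x u = u] = A.
  apply: mA; last by move=> x [].
  split.
  - apply: closedI => //; apply: (closed_equalizer hI (opc u)).
    by move=> x; exact: cvg_cst.
  - have : ([set op x u | x in A]) u by rewrite AuA.
    by move=> [x Ax xu]; exists x.
  - move=> x y [Ax /= xu] [Ay yu]; split; first exact: Aop.
    by rewrite /= -opA yu xu.
have : (A `&` [set x | op x u = u]) u by rewrite BA.
by case.
Qed.

Lemma pair_dynamic (T : monoid) (Z W : topologicalType) (a : T -> Z -> Z)
    (b : T -> W -> W) : compact_dynamic a -> compact_dynamic b ->
  compact_dynamic (fun t (z : Z * W) => (a t z.1, b t z.2)).
Proof.
move=> [cZ hZ [ca a1 am]] [cW hW [cb b1 bm]]; split.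
- rewrite -setXTT; exact: compact_setX.
- move=> [z w] [z' w'] cl; congr pair.
    apply: hZ => A B nA nB.
    have [||[x y] [/= [Ax _] [Bx _]]] := cl (A `*` setT) (B `*` setT).
    - by exists (A, setT) => //; split=> //=; exact: filterT.
    - by exists (B, setT) => //; split=> //=; exact: filterT.
    by exists x.
  apply: hW => A B nA nB.
  have [||[x y] [/= [_ Ay] [_ By]]] := cl (setT `*` A) (setT `*` B).
  - by exists (setT, A) => //; split=> //=; exact: filterT.
  - by exists (setT, B) => //; split=> //=; exact: filterT.
  by exists y.
- split=> [t [z w]|[z w]|s t [z w]] /=; rewrite ?a1 ?b1 ?am ?bm //.
  apply: cvg_pair => /=.
    by apply: continuous_cvg; [exact: ca|exact: cvg_fst].
  by apply: continuous_cvg; [exact: cb|exact: cvg_snd].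
Qed.

Section Universal.
Context (T : monoid) (I : topologicalType) (aI : T -> I -> I).
Hypothesis uI : universal_minimal aI.

Let cI : compact [set: I]. Proof. by case: uI => -[]. Qed.
Let hI : hausdorff_space I. Proof. by case: uI => -[]. Qed.
Let act : is_action aI. Proof. by case: uI => -[]. Qed.
Let mI : minimal aI. Proof. by case: uI. Qed.
Let cact t : continuous (aI t). Proof. by case: act. Qed.

Definition endo (f : I -> I) := hom aI aI f.

(** Universality maps [I] into the orbit closure of the identity in the product space of all maps
    [I -> I], that is, into the enveloping semigroup; [st m x] is the value at [x] of the image of
    [m]. Endomorphisms commute with translations, hence with their pointwise limits. *)
Lemma star_product : exists st : I -> I -> I,
  (forall x, endo (st^~ x)) /\
  (forall f, endo f -> forall m x, f (st m x) = st m (f x)).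
Proof.
pose aP (t : T) (w : {ptws I -> I}) : {ptws I -> I} := fun x => aI t (w x).
have evc x := @ptws_proj_continuous I I x.
have dP : compact_dynamic aP.
  split; [exact: ptws_compact| |split].
  - exact: (@hausdorff_product I (fun=> I) (fun=> hI)).
  - move=> t; apply: ptws_continuous => x w.
    by apply: continuous_comp; [exact: evc|exact: cact].
  - by move=> w; apply/funext => x; case: act => _ a1 _; exact: a1.
  - by move=> s t w; apply/funext => x; case: act => _ _; exact.
have iP : is_action aP by case: dP.
have caP : forall t, continuous (aP t) by case: iP.
pose i0 : {ptws I -> I} := id.
have [f [[cf ef] fE]] := universal_hom uI dP
  (@closed_closure _ (range (fun t => aP t i0)))
  (ex_intro _ i0 (orbit_closure_refl iP))
  (closure_invariant caP (orbit_invariant iP)).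
exists f; split.
  move=> x; split; last by move=> t m; rewrite ef.
  move=> m; apply: (@continuous_comp _ _ _ f (fun w : {ptws I -> I} => w x)).
    exact: cf.
  exact: evc.
move=> g [cg eg] m x.
pose B : set {ptws I -> I} := [set w | g (w x) = w (g x)].
suff : B (f m) by [].
have clB : closed B.
  apply: (closed_equalizer hI); last exact: evc.
  by move=> w; apply: continuous_comp; [exact: evc|exact: cg].
have := fE m; rewrite closureE; apply; split=> // _ [t _ <-].
by rewrite /B /= /aP eg.
Qed.

Lemma closed_range (f : I -> I) : continuous f -> closed (range f).
Proof.
move=> cf; apply: compact_closed => //; apply: continuous_compact => //.
exact: continuous_subspaceT.
Qed.

Lemma endo_surj f : endo f -> forall y, exists x, f x = y.
Proof.
move=> [cf ef] y; have [[m _] mm] := mI.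
have : range f y.
  rewrite (mm (range f)) //; first exact: closed_range.
    by exists (f m); exists m.
  by move=> t _ [x _ <-]; exists (aI t x).
by move=> [x _ <-]; exists x.
Qed.

(* Every endomorphism is a right multiplication for the star product, and
   idempotents, which are right identities, provide the inverses. *)
Lemma endo_inverse f : endo f ->
  exists g, [/\ endo g, cancel f g & cancel g f].
Proof.
move=> ef; have [st [stE stf]] := star_product.
have stc x : continuous (st^~ x) by case: (stE x).
(* Associativity says that the endomorphism [st^~ z] commutes with [st]. *)
have stA : associative st by move=> x y z; rewrite -(stf _ (stE z)).
have sts y := endo_surj (stE y).
have idR u : st u u = u -> forall x, st x u = x.
  by move=> uu x; have [y <-] := sts u x; rewrite -stA uu.
have idE S : closed S -> S !=set0 -> (forall x y, S x -> S y -> S (st x y)) ->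
    exists2 u, S u & st u u = u.
  by move=> *; exact: ellis_numakura.
have [[m0 _] _] := mI.
have [u _ uu] := idE setT closedT (ex_intro _ m0 Logic.I) (fun _ _ _ _ => Logic.I).
set v := f u.
have fv x : f x = st x v by rewrite -{1}(idR _ uu x) stf.
(* The elements fixing [v] from the left form a closed subsemigroup, nonempty because [st^~ v] is
   onto; its idempotent [w] is the unit for which [v] gets a two-sided inverse [v2]. *)
have [| | |w wv ww] := idE [set s | st s v = v].
- apply: (closed_equalizer hI (stc v)) => x; exact: cvg_cst.
- by have [x xv] := sts v v; exists x.
- by move=> x y /= xv yv; rewrite -stA yv.
have [v1 v1v] := sts v w.
set v2 := st w v1.
have v2v : st v2 v = w by rewrite -stA v1v.
have [z zv2] := sts v2 w.
have zv : z = v by rewrite -(idR _ ww z) -v2v stA zv2.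
have vv2 : st v v2 = w by rewrite -zv.
exists (st^~ v2); split=> [//|x|x].
  by rewrite fv -stA vv2 idR.
by rewrite fv -stA v2v idR.
Qed.

Lemma endo_aut f : endo f -> is_aut aI f.
Proof.
move=> ef; have [g [[cg _] fg gf]] := endo_inverse ef.
by case: (ef) => cf eqf; split; [split=> //; exact: endo_surj|exists g].
Qed.

Lemma aut_endo f : is_aut aI f -> endo f.
Proof. by move=> [[cf ef _] _]. Qed.

(** The first coordinate of an equivariant map from [I] into [M] is an endomorphism, hence
    invertible; precomposing with its inverse turns the map into a graph. *)
Lemma pair_graph (M : set (I * I)) :
  closed M -> M !=set0 -> invariant (pact aI) M ->
  exists2 al, endo al & forall m, M (m, al m).
Proof.
move=> clM M0 iM.
have dI : compact_dynamic aI by case: uI.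
have [f [[cf ef] fM]] := universal_hom uI (pair_dynamic dI dI) clM M0 iM.
have e1 : endo (fst \o f).
  split; last by move=> t m; rewrite /= ef.
  exact: continuous_compose cf (@fst_continuous _ _).
have e2 : endo (snd \o f).
  split; last by move=> t m; rewrite /= ef.
  exact: continuous_compose cf (@snd_continuous _ _).
have [g [[cg eg] _ gf]] := endo_inverse e1.
exists (snd \o f \o g).
  case: e2 => c2 e2; split; last by move=> t m; rewrite /= eg ef.
  exact: continuous_compose cg c2.
move=> m; have := fM (g m); have := gf m => /=.
by case: (f (g m)) => x y /= ->.
Qed.

Lemma triple_graph (M : set (I * I * I)) :
  closed M -> M !=set0 ->
  (forall t z, M z -> M (aI t z.1.1, aI t z.1.2, aI t z.2)) ->
  exists al be, [/\ endo al, endo be & forall m, M (m, al m, be m)].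
Proof.
move=> clM M0 iM.
have dI : compact_dynamic aI by case: uI.
have [f [[cf ef] fM]] :=
  universal_hom uI (pair_dynamic (pair_dynamic dI dI) dI) clM M0 iM.
have c1 : continuous (fst \o f).
  exact: continuous_compose cf (@fst_continuous _ _).
have e11 : endo (fun m => (f m).1.1).
  split; last by move=> t m; rewrite /= ef.
  exact: continuous_compose c1 (@fst_continuous _ _).
have e12 : endo (fun m => (f m).1.2).
  split; last by move=> t m; rewrite /= ef.
  exact: continuous_compose c1 (@snd_continuous _ _).
have e2 : endo (fun m => (f m).2).
  split; last by move=> t m; rewrite /= ef.
  exact: continuous_compose cf (@snd_continuous _ _).
have [g [[cg eg] _ gf]] := endo_inverse e11.
exists (fun m => (f (g m)).1.2), (fun m => (f (g m)).2); split.
- case: e12 => c2 e2'; split; last by move=> t m; rewrite /= eg ef.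
  exact: continuous_compose cg c2.
- case: e2 => c2 e2'; split; last by move=> t m; rewrite /= eg ef.
  exact: continuous_compose cg c2.
move=> m; have := fM (g m); have := gf m => /=.
by case: (f (g m)) => -[x y] z /= ->.
Qed.

End Universal.

(** * The tau-topology and derived groups *)

Lemma continuous_pair (A B C : topologicalType) (f : A -> B) (g : A -> C) :
  continuous f -> continuous g -> continuous (fun x => (f x, g x)).
Proof. by move=> cf cg x; apply: cvg_pair; [exact: cf|exact: cg]. Qed.

Lemma continuous_prod (A B C D : topologicalType) (f : A -> B) (g : C -> D) :
  continuous f -> continuous g -> continuous (fun z : A * C => (f z.1, g z.2)).
Proof.
move=> cf cg; apply: continuous_pair.
  exact: continuous_compose (@fst_continuous _ _) cf.
exact: continuous_compose (@snd_continuous _ _) cg.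
Qed.

Lemma open_preimage (A B : topologicalType) (f : A -> B) (N : set B) :
  continuous f -> open N -> open (f @^-1` N).
Proof. by move=> /continuousP; exact. Qed.

Section Graphs.
Context (I : topologicalType).
Implicit Types (al be de : I -> I) (N : set (I * I)) (S G : set (I -> I)).

Definition graph_meets de N := exists m, N (m, de m).

(** The maps whose graph meets a given open set play the role of basic tau-open sets, so [al] and
    [be] cannot be separated by tau-neighbourhoods inside [G]. For [be = id] this is the condition
    defining the derived group. *)
Definition near_in G al be := forall N1 N2, open N1 -> open N2 ->
  graph_meets al N1 -> graph_meets be N2 ->
  exists2 de, G de & graph_meets de N1 /\ graph_meets de N2.

Definition graph_closure S : set (I * I) := closure (\bigcup_(al in S) Gamma al).

Lemma graph_closureP S z : graph_closure S z <->
  forall N, open N -> N z -> exists2 s, S s & graph_meets s N.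
Proof.
split=> [cl N oN Nz|H B].
  have [_ [[s Ss [m _ <-]] Nm]] := cl _ (open_nbhs_nbhs (conj oN Nz)).
  by exists s => //; exists m.
rewrite nbhsE => -[N [oN Nz] NB]; have [s Ss [m Nm]] := H _ oN Nz.
by exists (m, s m); split; [exists s => //; exists m|exact: NB].
Qed.

Lemma graph_closed S : closed (graph_closure S).
Proof. exact: closed_closure. Qed.

Lemma graph_closure_sub S al m : S al -> graph_closure S (m, al m).
Proof. by move=> Sal; apply: subset_closure; exists al => //; exists m. Qed.

Lemma graph_closure_min S (A : set (I * I)) : closed A ->
  (forall al m, S al -> A (m, al m)) -> graph_closure S `<=` A.
Proof.
move=> clA SA; rewrite /graph_closure closureE => z; apply; split=> //.
by move=> _ [al Sal [m _ <-]]; exact: SA.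
Qed.

Lemma graph_closureS S G : S `<=` G -> graph_closure S `<=` graph_closure G.
Proof.
move=> SG; apply: graph_closure_min (@graph_closed _) _ => al m /SG.
exact: graph_closure_sub.
Qed.

Lemma near_in_sym G al be : near_in G al be -> near_in G be al.
Proof.
move=> nab N1 N2 oN1 oN2 m1 m2; have [de Gde []] := nab _ _ oN2 oN1 m2 m1.
by exists de.
Qed.

End Graphs.

Section Groups.
Context (T : monoid) (I : topologicalType) (aI : T -> I -> I).
Hypothesis uI : universal_minimal aI.
Implicit Types (al be de : I -> I) (N : set (I * I)) (S G : set (I -> I)).

Local Notation endo := (endo aI).

Let dI : compact_dynamic aI. Proof. by case: uI. Qed.
Let dII : compact_dynamic (pact aI). Proof. exact: pair_dynamic. Qed.
Let act : is_action aI. Proof. by case: dI. Qed.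
Let act2 : is_action (pact aI). Proof. by case: dII. Qed.
Let mI : minimal aI. Proof. by case: uI. Qed.
Let cact2 t : continuous (pact aI t). Proof. by case: act2. Qed.

Definition subgroup G := [/\ (forall al, G al -> endo al), G id,
  (forall al be, G al -> G be -> G (al \o be)) &
  (forall al, G al -> exists be, [/\ G be, cancel al be & cancel be al])].

Lemma endo_id : endo id.
Proof. by split=> [x|//]; exact: cvg_id. Qed.

Lemma endo_comp al be : endo al -> endo be -> endo (al \o be).
Proof.
move=> [ca ea] [cb eb]; split; first exact: continuous_compose cb ca.
by move=> t m; rewrite /= eb ea.
Qed.

(** The points whose graph point lies in [N] form a nonempty open set, which every orbit of a
    minimal action meets. Thus tau-neighbourhoods can be tested along the orbit of one point. *)
Lemma graph_orbit al N m : endo al -> open N -> graph_meets al N ->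
  exists t, N (aI t m, al (aI t m)).
Proof.
move=> [ca ea] oN [n Nn].
pose U := [set x | N (x, al x)].
have oU : open U.
  apply: (open_preimage _ oN); apply: continuous_pair => //.
  by move=> x; exact: cvg_id.
by have [|t Ut] := @minimal_dense_orbit _ _ _ m U act mI oU; [exists n|exists t].
Qed.

Lemma graph_closure_invariant S : S `<=` endo ->
  invariant (pact aI) (graph_closure S).
Proof.
move=> Se; apply: closure_invariant => // t _ [al Sal [m _ <-]].
exists al => //; exists (aI t m) => //; congr pair => /=.
by have [_ ->] := Se _ Sal.
Qed.

(** Testing a single open set at a time is enough: compatibility with finite unions is recovered in
    [tau_closureU] from the closures of graphs. *)
Definition tau_closure S : set (I -> I) := [set al | endo al /\
  forall N, open N -> graph_meets al N -> exists2 s, S s & graph_meets s N].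

Definition tau_closed S := tau_closure S `<=` S.

(** One point of the graph suffices, since the graph closure is invariant and the orbit of that
    point enters every open set met by the graph. *)
Lemma tau_closure_graph S al m : S `<=` endo -> endo al ->
  graph_closure S (m, al m) -> tau_closure S al.
Proof.
move=> Se eal cl; split=> // N oN mN.
have [t Nt] := graph_orbit m eal oN mN.
have := graph_closure_invariant Se (t := t) cl; rewrite /pact /=.
have [_ eq] := eal; rewrite -eq => /graph_closureP; exact.
Qed.

Lemma graph_closure_tau S al m : tau_closure S al -> graph_closure S (m, al m).
Proof. by move=> [_ H]; apply/graph_closureP => N oN Nm; apply: H => //; exists m. Qed.

Lemma sub_tau_closure S : S `<=` endo -> S `<=` tau_closure S.
Proof. by move=> Se al Sal; split; [exact: Se|move=> N _ mN; exists al]. Qed.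

Lemma tau_closureS S G : S `<=` G -> tau_closure S `<=` tau_closure G.
Proof.
move=> SG al [eal H]; split=> // N oN /(H _ oN) [s Ss mN].
by exists s => //; exact: SG.
Qed.

Lemma tau_closureU S G : S `<=` endo -> G `<=` endo ->
  tau_closure (S `|` G) `<=` tau_closure S `|` tau_closure G.
Proof.
move=> Se Ge al [eal H]; have [[m _] _] := mI.
apply: contrapT => /not_orP [nS nG].
have : graph_closure (S `|` G) (m, al m).
  by apply: graph_closure_tau; split.
rewrite /graph_closure bigcup_setU closureU => -[|] cl.
  by apply: nS; exact: tau_closure_graph cl.
by apply: nG; exact: tau_closure_graph cl.
Qed.

Lemma tau_closure_idem S : tau_closure (tau_closure S) `<=` tau_closure S.
Proof.
move=> al [eal H]; split=> // N oN /(H _ oN) [s [es Hs]]; exact: Hs.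
Qed.

(* The graph closures decrease to a nonempty closed invariant set, which
   contains the graph of an automorphism. *)
Lemma tau_compact (C : set (set (I -> I))) : C !=set0 ->
  (forall S, C S -> S !=set0 /\ S `<=` endo) ->
  (forall A B, C A -> C B -> exists2 D, C D & D `<=` A `&` B) ->
  exists2 al, endo al & forall S, C S -> tau_closure S al.
Proof.
move=> [S0 CS0] CC Cdir; have [[m0 _] _] := mI.
pose D := [set graph_closure S | S in C].
have [c2 _ _] := dII.
have D0 : \bigcap_(A in D) A !=set0.
  apply: compact_bigcap => //.
  - by exists (graph_closure S0); exists S0.
  - move=> _ [S CS <-]; split; first exact: graph_closed.
    have [[s Ss] _] := CC _ CS; exists (m0, s m0); exact: graph_closure_sub.
  - move=> _ _ [A CA <-] [B CB <-]; have [E CE sE] := Cdir _ _ CA CB.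
    exists (graph_closure E); first by exists E.
    by move=> z Ez; split; apply: graph_closureS Ez => x /sE [].
have clD : closed (\bigcap_(A in D) A).
  by apply: closed_bigI => _ [S CS <-]; exact: graph_closed.
have iD : invariant (pact aI) (\bigcap_(A in D) A).
  move=> t x Dx _ [S CS <-]; have [_ Se] := CC _ CS.
  by apply: graph_closure_invariant => //; apply: Dx; exists S.
have [al eal Dal] := pair_graph uI clD D0 iD.
exists al => // S CS; have [_ Se] := CC _ CS.
by apply: (@tau_closure_graph _ _ m0) => //; apply: Dal; exists S.
Qed.

Lemma open_tensor al be N : continuous al -> continuous be -> open N ->
  open [set z : I * I | N (al z.1, be z.2)].
Proof. by move=> ca cb; apply: open_preimage; exact: continuous_prod. Qed.

(** Left and right multiplications are tau-continuous: the graph of [ga \o al \o ga'] meets [N]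
    exactly when that of [al] meets the preimage of [N] under the product of the inverse of [ga']
    with [ga]. *)
Lemma near_in_translate (G G' : set (I -> I)) al be ga ga' :
  endo ga -> endo ga' ->
  (exists ga'1, cancel ga' ga'1 /\ cancel ga'1 ga') ->
  (forall de, G de -> G' (ga \o de \o ga')) ->
  near_in G al be -> near_in G' (ga \o al \o ga') (ga \o be \o ga').
Proof.
move=> [cg _] [cg' eg'] [h [gh hg]] GG nab N1 N2 oN1 oN2 [m1 N1m] [m2 N2m].
have ch : continuous h.
  have [h' [[ch' _] c1 c2]] := endo_inverse uI (conj cg' eg').
  suff -> : h = h' by [].
  by apply/funext => x; rewrite -{1}(c2 x) gh.
have o1 := open_tensor ch cg oN1; have o2 := open_tensor ch cg oN2.
have [||de Gde [[x1 M1] [x2 M2]]] := nab _ _ o1 o2.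
- by exists (ga' m1); rewrite /= gh.
- by exists (ga' m2); rewrite /= gh.
exists (ga \o de \o ga'); first exact: GG.
by split; [exists (h x1)|exists (h x2)]; rewrite /= hg.
Qed.

(** This removes nets from the derived group. The converse direction builds a net that converges at
    all points of [I] at once, although [near_in] controls only one open set for each of the two
    limits. *)
Lemma derived_near G al : G `<=` endo -> derived G al <-> G al /\ near_in G al id.
Proof.
move=> Ge; split=> [[Gal [D [le [d [dir Gd da d1]]]]]|[Gal nal]]; split=> //.
  move=> N1 N2 oN1 oN2 [m1 M1] [m2 M2].
  have [mi [mi1 mi2]] := da m1; have [ni [ni1 ni2]] := d1 m2.
  have [_ _ tr up] := dir.
  have ev be (N : set (I * I)) m (x : D -> I) : open N -> N (m, be m) -> net_to le x m ->
      net_to le (fun i => d i (x i)) (be m) ->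
      exists i0, forall i, le i0 i -> N (x i, d i (x i)).
    move=> oN Nm n1 n2.
    have [[A B] [/= nA nB] sAB] : nbhs (m, be m) N by exact: open_nbhs_nbhs.
    have [i Hi] := n1 _ nA; have [j Hj] := n2 _ nB; have [k [ik jk]] := up i j.
    exists k => l kl; apply: sAB; split; first by apply: Hi; exact: tr kl.
    by apply: Hj; exact: tr kl.
  have [i Hi] := ev al _ _ _ oN1 M1 mi1 mi2.
  have [j Hj] := ev id _ _ _ oN2 M2 ni1 ni2.
  have [k [ik jk]] := up i j.
  exists (d k); first exact: Gd.
  by split; [exists (mi k); exact: Hi|exists (ni k); exact: Hj].
(* The net is indexed by finite lists of constraints, each a point with an open set, ordered by
   inclusion. [W be c m] is the neighbourhood of [(m, be m)] that the list [c] prescribes. *)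
pose D := seq (I * set (I * I)).
pose le (c c' : D) := forall x, List.In x c -> List.In x c'.
pose W be (c : D) m : set (I * I) := [set z |
  forall N, List.In (m, N) c -> open N -> N (m, be m) -> N z].
have nW be c m : nbhs (m, be m) (W be c m).
  elim: c => [|[n N] c IH]; first by apply: (@filterE _ (nbhs (m, be m))) => z N [].
  have [[E [oN Nm]]|nE] := pselect (n = m /\ (open N /\ N (m, be m))).
    have nN : nbhs (m, be m) N by exact: open_nbhs_nbhs.
    apply: (@filterS2 _ (nbhs (m, be m)) _ _ _ _ _ IH nN) => z Wz Nz N' [[_ <-]//|].
    exact: Wz.
  apply: (@filterS _ (nbhs (m, be m)) _ _ _ _ IH) => z Wz N'.
  case=> [[nm NN'] oN' Nm'|]; last exact: Wz.
  by case: nE; rewrite NN'.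
have [[m0 _] _] := mI.
(* The orbit of [(m0, be m0)] visits each prescribed neighbourhood, and continues to do so for all
   nearby pairs. Finitely many constraints are thereby encoded in one neighbourhood of
   [(m0, be m0)]. *)
have nT be c : endo be ->
    nbhs (m0, be m0) [set z | forall m, exists t, W be c m (pact aI t z)].
  move=> ebe.
  have one m : nbhs (m0, be m0) [set z | exists t, W be c m (pact aI t z)].
    have [||t Wt] := @graph_orbit be (interior (W be c m)) m0 ebe.
    - exact: open_interior.
    - by exists m; exact: nW.
    have [_ eb] := ebe; rewrite eb in Wt.
    have nt : nbhs (m0, be m0) (pact aI t @^-1` W be c m).
      exact: (cact2 (t := t) (x := (m0, be m0)) Wt).
    by apply: (@filterS _ (nbhs (m0, be m0)) _ _ _ _ nt) => z Wz; exists t.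
  have fin (l : seq I) : nbhs (m0, be m0)
      [set z | forall m, List.In m l -> exists t, W be c m (pact aI t z)].
    elim: l => [|x l IH]; first by apply: (@filterE _ (nbhs (m0, be m0))) => z m [].
    apply: (@filterS2 _ (nbhs (m0, be m0)) _ _ _ _ _ IH (one x)) => z Wz Wx m.
    by case=> [<-//|]; exact: Wz.
  apply: (@filterS _ (nbhs (m0, be m0)) _ _ _ _ (fin (map fst c))) => z Hz m.
  have [/Hz//|nm] := pselect (List.In m (map fst c)).
  (* A point absent from the list carries no constraint, so any time would do. *)
  exists (mone T) => N Nc; case: nm.
  exact: (List.in_map fst c (m, N)).
have key (c : D) : exists de, G de /\ forall m,
    (exists x, W al c m (x, de x)) /\ (exists x, W id c m (x, de x)).
  pose V be := interior [set z | forall m, exists t, W be c m (pact aI t z)].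
  have [||de Gde [[x1 M1] [x2 M2]]] :=
    nal (V al) (V id) (@open_interior _ _) (@open_interior _ _).
  - exists m0; exact: (nT al c (Ge _ Gal)).
  - exists m0; exact: (nT id c endo_id).
  exists de; split=> // m; have [_ ed] := Ge _ Gde; split.
    have [t Wt] := interior_subset M1 m; exists (aI t x1).
    by rewrite ed; exact: Wt.
  have [t Wt] := interior_subset M2 m; exists (aI t x2).
  by rewrite ed; exact: Wt.
have [d Hd] := choice key.
have tau be (Hbe : forall c m, exists x, W be c m (x, d c x)) : tau_to le d be.
  move=> m; have [mi Hmi] := choice (fun c => Hbe c m).
  exists mi; split=> U; rewrite nbhsE => -[V [oV Vm] VU].
    exists [:: (m, fst @^-1` V)] => c lec.
    apply: VU; apply: (Hmi c (fst @^-1` V)) => //; first by apply: lec; left.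
    exact: open_preimage (@fst_continuous _ _) oV.
  exists [:: (m, snd @^-1` V)] => c lec.
  apply: VU; apply: (Hmi c (snd @^-1` V)) => //; first by apply: lec; left.
  exact: open_preimage (@snd_continuous _ _) oV.
exists D, le, d; split.
- split.
  + exact: inhabits [::].
  + by move=> i x.
  + by move=> i j k ij jk x /ij /jk.
  + move=> i j; exists (i ++ j); split=> x xi; apply: List.in_or_app.
      by left.
    by right.
- by move=> c; case: (Hd c).
- by apply: tau => c m; have [_ /(_ m) []] := Hd c.
- by apply: tau => c m; have [_ /(_ m) []] := Hd c.
Qed.

Lemma subgroup_endo G : subgroup G -> G `<=` endo.
Proof. by case. Qed.

Lemma near_in_refl G al : G al -> near_in G al al.
Proof. by move=> Gal N1 N2 _ _ m1 m2; exists al. Qed.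

Lemma derived_sub G : derived G `<=` G.
Proof. by move=> al []. Qed.

Lemma derived_subgroup G : subgroup G -> subgroup (derived G).
Proof.
move=> sG; have [Ge G1 Gm Gv] := sG; have dE := derived_near _ Ge.
split.
- by move=> al /derived_sub /Ge.
- by apply/dE; split=> //; exact: near_in_refl.
(* The factors are replaced one after the other: first [al] by some [de] close to both [al] and
   [id], keeping [be] on the right, then [be] by some [ep] close to both [be] and [id], keeping [de]
   on the left. *)
- move=> al be /dE [Gal nal] /dE [Gbe nbe]; apply/dE; split; first exact: Gm.
  move=> N1 N2 oN1 oN2 [m1 M1] m2.
  have [be' [Gbe' bb' b'b]] := Gv _ Gbe.
  have [cb' _] := Ge _ Gbe'.
  have cid : continuous (@idfun I) by move=> x; exact: cvg_id.
  have [|de Gde [[x X] [y Y]]] := nal _ N2 (open_tensor cb' cid oN1) oN2 _ m2.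
    by exists (be m1); rewrite /= bb'.
  have [cd _] := Ge _ Gde.
  have [||ep Gep [[u U] [v V]]] :=
    nbe _ _ (open_tensor cid cd oN1) (open_tensor cid cd oN2).
  - by exists (be' x); rewrite /= b'b.
  - by exists y.
  exists (de \o ep); first exact: Gm.
  by split; [exists u|exists v].
- move=> al /dE [Gal nal]; have [be [Gbe ab ba]] := Gv _ Gal.
  exists be; split=> //; apply/dE; split=> //; apply: near_in_sym.
  have := @near_in_translate G G al id be id (Ge _ Gbe) endo_id _ _ nal.
  have -> : be \o al \o id = id by apply/funext => x /=; rewrite ab.
  have -> : be \o id \o id = be by [].
  by apply; [exists id|move=> de Gde; exact: (Gm _ _ Gbe Gde)].
Qed.

Lemma bigcap_subgroup (S : set (set (I -> I))) : S !=set0 ->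
  (forall G, S G -> subgroup G) -> subgroup (\bigcap_(G in S) G).
Proof.
move=> [G0 SG0] Ssub; split.
- by move=> al /(_ _ SG0); case: (Ssub _ SG0) => + _ _ _; apply.
- by move=> G /Ssub [].
- move=> al be Sal Sbe G SG; have [_ _ Gm _] := Ssub _ SG.
  by apply: Gm; [exact: Sal|exact: Sbe].
- move=> al Sal; have [_ _ _ /(_ _ (Sal _ SG0)) [be [_ ab ba]]] := Ssub _ SG0.
  exists be; split=> // G SG.
  have [_ _ _ /(_ _ (Sal _ SG)) [be' [Gbe' ab' ba']]] := Ssub _ SG.
  suff -> : be = be' by [].
  by apply/funext => x; rewrite -{1}(ba' x) ab.
Qed.

Lemma stage_subgroup F G : subgroup F -> stage F G -> subgroup G.
Proof.
move=> sF; elim=> [//|G' _|S S0 _ IH]; first exact: derived_subgroup.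
exact: bigcap_subgroup.
Qed.

(** The intersection of all stages is itself a limit stage, so its derived group is again a stage
    and contains it. This is the stability of the transfinite sequence. *)
Lemma stage_Finf (F : set (I -> I)) : stage F (Finf F).
Proof. by apply: stage_lim => //; exists F; exact: stage_base. Qed.

Lemma Finf_subgroup F : subgroup F -> subgroup (Finf F).
Proof. by move=> sF; exact: stage_subgroup sF (stage_Finf F). Qed.

(** The quotient of [be] by [al] lies in [Finf F], hence in its derived group, so it is near the
    identity; left translation by [al] concludes. *)
Lemma Finf_near F al be : subgroup F -> Finf F al -> Finf F be ->
  near_in (Finf F) al be.
Proof.
move=> sF Fal Fbe; have sFi := Finf_subgroup sF.
have [Fe F1 Fm Fv] := sFi.
have [al' [Fal' aa' a'a]] := Fv _ Fal.
have : derived (Finf F) (al' \o be).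
  have := Fm _ _ Fal' Fbe; apply; exact: stage_succ (stage_Finf F).
move=> /(derived_near _ Fe) [_ nal].
have := @near_in_translate (Finf F) (Finf F) _ _ al id (Fe _ Fal) endo_id _ _ nal.
have -> : al \o (al' \o be) \o id = be by apply/funext => x /=; rewrite a'a.
have -> : al \o id \o id = al by [].
move=> H; apply: near_in_sym; apply: H; first by exists id.
by move=> de Fde; exact: (Fm _ _ Fal Fde).
Qed.

End Groups.

(** * Closures of unions of graphs *)

Lemma open_rectangle (A B : topologicalType) (U : set A) (V : set B) :
  open U -> open V -> open (U `*` V).
Proof.
move=> oU oV; apply: openI.
  exact: open_preimage (@fst_continuous _ _) oU.
exact: open_preimage (@snd_continuous _ _) oV.
Qed.

Lemma sub_rectangle (A B : topologicalType) (z : A * B) (N : set (A * B)) :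
  open N -> N z -> exists U V,
    [/\ open U, open V, U z.1, V z.2 & U `*` V `<=` N].
Proof.
move=> oN Nz; have [[U V] [/= nU nV] sUV] : nbhs z N by exact: open_nbhs_nbhs.
exists U°, V°; split; try exact: open_interior; try by [].
by move=> w [/interior_subset Uw /interior_subset Vw]; exact: sUV.
Qed.

Lemma closed_preimage (A B : topologicalType) (f : A -> B) (N : set B) :
  continuous f -> closed N -> closed (f @^-1` N).
Proof. by move=> /continuous_closedP; exact. Qed.

Section GraphClosure.
Context (T : monoid) (I : topologicalType) (aI : T -> I -> I).
Hypothesis uI : universal_minimal aI.
Implicit Types (al be de : I -> I) (N : set (I * I)) (S G K : set (I -> I)).

Local Notation endo := (endo aI).

Let dI : compact_dynamic aI. Proof. by case: uI. Qed.
Let cI : compact [set: I]. Proof. by case: dI. Qed.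
Let hI : hausdorff_space I. Proof. by case: dI. Qed.
Let dII : compact_dynamic (pact aI). Proof. exact: pair_dynamic. Qed.
Let mI : minimal aI. Proof. by case: uI. Qed.

(* [C] comes from the symbolic flow of all maps [T -> bool]: it records the
   times [t] at which [t] moves some [al m0] into [N]. *)
Lemma clopen_sandwich S (N : set I) : S `<=` endo -> open N ->
  exists C : set I, [/\ open C, open (~` C),
    (forall al m, S al -> N (al m) -> C m) &
    (forall m O, C m -> open O -> O m ->
       exists2 al, S al & exists2 n, O n & N (al n))].
Proof.
move=> Se oN.
pose W := {ptws {classic T} -> bool}.
pose aW (t : T) (w : W) : W := fun s => w (mmul (s : T) t : {classic T}).
have evc s : continuous (fun w : W => w s) by exact: ptws_proj_continuous.
have dW : compact_dynamic aW.
  split; [exact: ptws_compact bool_compact| |split].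
  - exact: (@hausdorff_product {classic T} (fun=> bool) (fun=> discrete_hausdorff)).
  - by move=> t; apply: ptws_continuous => s; exact: evc.
  - by move=> w; apply/funext => s; rewrite /aW mmulm1.
  - by move=> s t w; apply/funext => r; rewrite /aW mmulA.
pose aZ (t : T) (z : I * W) := (aI t z.1, aW t z.2).
have dZ : compact_dynamic aZ by exact: pair_dynamic.
have actZ : is_action aZ by case: dZ.
have caZ : forall t, continuous (aZ t) by case: actZ.
have [[m0 _] _] := mI.
pose w0 : W := fun s => `[< exists2 al, S al & N (al (aI (s : T) m0)) >].
have [f [[cf ef] fM]] := universal_hom uI dZ
  (@closed_closure _ (range (fun t => aZ t (m0, w0))))
  (ex_intro _ (m0, w0) (orbit_closure_refl actZ))
  (closure_invariant caZ (orbit_invariant actZ)).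
have c1 : continuous (fst \o f) := continuous_compose cf (@fst_continuous _ _).
have e1 : endo (fst \o f) by split=> // t m /=; rewrite ef.
have [g [[cg eg] _ gf]] := endo_inverse uI e1.
(* As the first coordinate has been inverted, the symbolic point above [m] depends continuously on
   [m]. Its symbol at time one takes values in a discrete space, so its level sets are clopen. *)
pose c m := (f (g m)).2 (mone T : {classic T}).
have cc : continuous c.
  exact: (continuous_compose cg (continuous_compose
    (continuous_compose cf (@snd_continuous _ _)) (evc (mone T)))).
(* The point above [m] is a limit of translates of [(m0, w0)], so the symbol at [m] is realized by
   [w0] at times that bring [m0] close to [m]. *)
have approx m O b : open O -> O m -> c m = b ->
    exists2 t, O (aI t m0) & w0 (t : {classic T}) = b.
  move=> oO Om cmb.
  have ob : open [set w : W | w (mone T : {classic T}) = b].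
    apply: (@open_preimage _ _ (fun w : W => w (mone T : {classic T})) [set b]).
      exact: evc.
    exact: discrete_open.
  have /(_ (O `*` [set w : W | w (mone T : {classic T}) = b])) := fM (g m).
  case.
    apply: open_nbhs_nbhs; split; first exact: open_rectangle.
    by split=> //=; have /= -> := gf m.
  move=> _ [[t _ <-] [/= Ot]]; rewrite /aW mmul1 => Ht.
  by exists t.
exists [set m | c m = true]; split.
- exact: (open_preimage (N := [set true]) cc (discrete_open _)).
- have -> : ~` [set m | c m = true] = c @^-1` [set false].
    by apply/seteqP; split=> m /=; case: (c m).
  exact: (open_preimage cc (discrete_open _)).
- move=> al m Sal Nal; apply: contrapT => /= /negP cm.
  have [ca ea] := Se _ Sal.
  have [t Nt] := approx m (al @^-1` N) false (open_preimage ca oN) Nal (negbTE cm).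
  by move/asboolP; apply; exists al.
- move=> m O cm oO Om; have [t Ot /asboolP[al Sal Nt]] := approx m O true oO Om cm.
  by exists al => //; exists (aI t m0).
Qed.

(** Lower semicontinuity of the fibres, that is, openness of the relation. The clopen set [C] of the
    sandwich contains [m], since otherwise the rectangle of its complement with [N] would contain a
    graph point; it is the required neighbourhood. *)
Lemma graph_closure_lsc S m b (N0 : set I) : S `<=` endo ->
  graph_closure S (m, b) -> nbhs b N0 ->
  nbhs m [set m' | exists2 b', N0 b' & graph_closure S (m', b')].
Proof.
move=> Se mb nN0.
have [N [oN Nb clN]] : exists N : set I, [/\ open N, N b & closure N `<=` N0].
  have [|B nB BN] := @compact_regular _ b setT hI cI _ _ nN0; first exact: filterT.
  exists B°; split; [exact: open_interior|exact: nB|].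
  by apply: subset_trans BN; apply: closure_subset; exact: interior_subset.
have [C [oC oC' SC CS]] := clopen_sandwich Se oN.
have Cm : C m.
  apply: contrapT => nCm.
  have [|al Sal [n [/= nCn Nn]]] :=
    (graph_closureP S (m, b)).1 mb _ (open_rectangle oC' oN) => //.
  exact: nCn (SC _ _ Sal Nn).
apply: (@filterS _ (nbhs m) _ C); last exact: open_nbhs_nbhs.
move=> m' Cm'.
(* Graph points with second coordinate in [N] accumulate over every point of [C]; as [A] has a
   closed projection, the fibre there meets the closure of [N]. *)
pose A := graph_closure S `&` [set z | closure N z.2].
have clA : closed A.
  apply: closedI; first exact: graph_closed.
  exact: closed_preimage (@snd_continuous _ _) (@closed_closure _ N).
have clf : closed (fst @` A).
  apply: compact_closed => //; apply: continuous_compact.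
    by apply: continuous_subspaceT; exact: fst_continuous.
  by case: dII => c2 _ _; exact: subclosed_compact clA c2 (@subsetT _ _).
have [[x y] [xy Ny] /= xm] : (fst @` A) m'.
  apply: clf => V; rewrite nbhsE => -[O [oO Om'] OV].
  have [al Sal [n On Nn]] := CS _ _ Cm' oO Om'.
  exists n; split; last exact: OV.
  by exists (n, al n) => //; split; [exact: graph_closure_sub|exact: subset_closure].
by exists y; [exact: clN|rewrite -xm].
Qed.

Definition icer (E : set (I * I)) := [/\ closed E, invariant (pact aI) E,
  (forall m, E (m, m)), (forall m n, E (m, n) -> E (n, m)) &
  (forall m n l, E (m, n) -> E (n, l) -> E (m, l))].

Lemma graph_closure_sym K m n : subgroup aI K ->
  graph_closure K (m, n) -> graph_closure K (n, m).
Proof.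
move=> [_ _ _ Kv].
have cswap : continuous (fun z : I * I => (z.2, z.1)).
  by apply: continuous_pair; [exact: snd_continuous|exact: fst_continuous].
apply: (graph_closure_min (A := (fun z => (z.2, z.1)) @^-1` graph_closure K)).
  apply: closed_preimage => //; exact: graph_closed.
move=> al x Kal /=; have [be [Kbe ab _]] := Kv _ Kal.
by have := graph_closure_sub (m := al x) Kbe; rewrite ab.
Qed.

(** Transitivity is the substantial point. Approximate [(a, b)] by [(x, al x)]; lower semicontinuity
    moves [(b, c)] to a pair [(al x, c')] of the relation with [c'] close to [c]. Precomposing
    graphs with [al] replaces [al x] by [x]. *)
Lemma graph_closure_icer K : subgroup aI K -> icer (graph_closure K).
Proof.
move=> sK; have [Ke K1 Km Kv] := sK; split.
- exact: graph_closed.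
- exact: graph_closure_invariant.
- by move=> m; exact: (graph_closure_sub (m := m) K1).
- by move=> m n; exact: graph_closure_sym.
move=> a b c ab bc; apply/graph_closureP => N oN Nac.
have [A [C [oA oC Aa Cc AC]]] := sub_rectangle oN Nac.
have := graph_closure_lsc Ke bc (open_nbhs_nbhs (conj oC Cc)).
rewrite nbhsE => -[B [oB Bb] BC].
have [|al Kal [x [/= Ax /BC [c' Cc' alc]]]] :=
  (graph_closureP K (a, b)).1 ab _ (open_rectangle oA oB) => //.
have [be [Kbe ab' ba]] := Kv _ Kal.
have xc' : graph_closure K (x, c').
  have [cb _] := Ke _ Kbe.
  have sub : graph_closure K `<=`
      (fun z : I * I => (be z.1, z.2)) @^-1` graph_closure K.
    apply: graph_closure_min.
      apply: closed_preimage; last exact: graph_closed.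
      apply: (@continuous_prod _ _ _ _ be id) => // ?; exact: cvg_id.
    move=> de m Kde /=.
    by have := graph_closure_sub (m := be m) (Km _ _ Kde Kal); rewrite /= ba.
  by have := sub _ alc; rewrite /= ab'.
apply: (graph_closureP K (x, c')).1 => //; exact: AC.
Qed.

Definition group_of (E : set (I * I)) : set (I -> I) :=
  [set al | endo al /\ forall m, E (m, al m)].

Lemma group_of_subgroup E : icer E -> subgroup aI (group_of E).
Proof.
move=> [clE iE rE sE tE]; split.
- by move=> al [].
- by split; [exact: endo_id|].
- move=> al be [ea Ea] [eb Eb]; split; first exact: endo_comp.
  by move=> m /=; exact: tE (Eb m) (Ea _).
- move=> al [ea Ea]; have [be [eb ab ba]] := endo_inverse uI ea.
  exists be; split=> //; split=> // m; apply: sE.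
  by have := Ea (be m); rewrite ba.
Qed.

Lemma group_of_tau_closed E : closed E -> tau_closed aI (group_of E).
Proof.
move=> clE al cl; split; first by case: cl.
move=> m; apply: (graph_closure_min clE (S := group_of E)).
  by move=> be n [].
exact: graph_closure_tau cl.
Qed.

Lemma group_of_graph_closure K : subgroup aI K -> tau_closed aI K ->
  group_of (graph_closure K) = K.
Proof.
move=> [Ke _ _ _] cK; apply/seteqP; split=> [al [ea Ea]|al Kal].
  have [[m _] _] := mI; apply: cK.
  exact: (tau_closure_graph uI Ke ea (Ea m)).
by split; [exact: Ke|move=> m; exact: graph_closure_sub].
Qed.

Lemma graph_closure_group_of E : closed E -> graph_closure (group_of E) `<=` E.
Proof. by move=> clE; apply: graph_closure_min => // al m []. Qed.

End GraphClosure.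

(** * Products of tau-closed groups *)

Section Products.
Context (T : monoid) (I : topologicalType) (aI : T -> I -> I).
Hypothesis uI : universal_minimal aI.
Implicit Types (al be de : I -> I) (N : set (I * I)) (S G H K : set (I -> I)).

Local Notation endo := (endo aI).
Local Notation group_of := (group_of aI).
Local Notation icer := (icer aI).
Local Notation tau_closed := (tau_closed aI).

Let dI : compact_dynamic aI. Proof. by case: uI. Qed.
Let hI : hausdorff_space I. Proof. by case: dI. Qed.
Let dII : compact_dynamic (pact aI). Proof. exact: pair_dynamic. Qed.
Let h2 : hausdorff_space (I * I)%type. Proof. by case: dII. Qed.
Let mI : minimal aI. Proof. by case: uI. Qed.

Definition aprod H S : set (I -> I) :=
  [set al | exists h s, [/\ H h, S s & al = h \o s]].

Let c11 : continuous (fun z : I * I * I => z.1.1) :=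
  continuous_compose (@fst_continuous _ _) (@fst_continuous _ _).
Let c12 : continuous (fun z : I * I * I => z.1.2) :=
  continuous_compose (@fst_continuous _ _) (@snd_continuous _ _).
Let c2 : continuous (fun z : I * I * I => z.2) := @snd_continuous _ _.

(** The composite of the graph closure of [S] with [E] is closed by compactness and contains the
    graphs of all products, so every limit [al] factors pointwise through an intermediate point.
    Universality turns the intermediate points into an automorphism [si]. *)
Lemma aprod_tau_closed (E : set (I * I)) S : icer E -> S `<=` endo ->
  tau_closed S -> tau_closed (aprod (group_of E) S).
Proof.
move=> [clE iE rE sE tE] Se cS al cl; have eal : endo al by case: cl.
have [[m0 _] _] := mI.
pose A := [set z : I * I * I | graph_closure S (z.1.1, z.1.2) /\ E (z.1.2, z.2)].
have clA : closed A.
  apply: closedI.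
    apply: (@closed_preimage _ _ (fun z : I * I * I => (z.1.1, z.1.2))).
      exact: continuous_pair.
    exact: graph_closed.
  apply: (@closed_preimage _ _ (fun z : I * I * I => (z.1.2, z.2))) => //.
  exact: continuous_pair.
pose pr (z : I * I * I) := (z.1.1, z.2).
have cpr : continuous pr by exact: continuous_pair.
have clp : closed (pr @` A).
  apply: compact_closed => //; apply: continuous_compact.
    exact: continuous_subspaceT.
  have [c3 _ _] := pair_dynamic dII dI.
  exact: subclosed_compact clA c3 (@subsetT _ _).
have [[[m b] c] [/= mb bc] [mm0 cc]] : (pr @` A) (m0, al m0).
  have sub : graph_closure (aprod (group_of E) S) `<=` pr @` A.
    apply: graph_closure_min => // _ m [h [s [[_ Hh] Ss ->]]].
    exists (m, s m, h (s m)) => //; split; last exact: Hh.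
    exact: graph_closure_sub.
  by apply: sub; exact: graph_closure_tau cl.
rewrite /= in mm0 cc; rewrite mm0 in mb; rewrite cc in bc.
have [ca ea] := eal.
(* The added equation forces the third coordinate of the triple of graphs to be [al]. *)
have [||t z [[Az1 Az2] /= z2]|si [be [es eb sb]]] :=
  @triple_graph _ _ _ uI (A `&` [set z | z.2 = al z.1.1]).
- apply: closedI => //; apply: closed_equalizer => //.
  exact: continuous_compose c11 ca.
- by exists (m0, b, al m0).
- split; last by rewrite /= z2 ea.
  split=> /=; first exact: (graph_closure_invariant uI Se (t := t) Az1).
  exact: (iE t _ Az2).
have Ssi : S si.
  by apply: cS; have [[/= sm _] _] := sb m0; exact: (tau_closure_graph uI Se es sm).
have [si' [es' ss' s's]] := endo_inverse uI es.
exists (al \o si'), si; split=> //.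
  split; first exact: endo_comp.
  by move=> n; have [[_ /= Eb] /= beE] := sb (si' n); rewrite s's beE in Eb.
by apply/funext => x /=; rewrite ss'.
Qed.

(** Conjugation by elements of [H] preserves nearness to the identity in [K], so [H] normalizes the
    derived group. *)
Lemma aprod_subgroup H K : subgroup aI H -> subgroup aI K -> H `<=` K ->
  subgroup aI (aprod H (derived K)).
Proof.
move=> [He H1 Hm Hv] sK HK; have [Ke K1 Km Kv] := sK.
have [De D1 Dm Dv] := derived_subgroup uI sK.
have dE := derived_near uI _ Ke.
have conj al h h' : derived K al -> H h -> H h' -> cancel h h' -> cancel h' h ->
    derived K (h \o al \o h').
  move=> /dE [Kal nal] Hh Hh' hh' h'h; apply/dE; split.
    by apply: (Km _ _ _ (HK _ Hh')); apply: Km => //; exact: HK.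
  have := @near_in_translate _ _ _ uI K K _ _ h h' (He _ Hh) (He _ Hh') _ _ nal.
  have -> : h \o id \o h' = id by apply/funext => x /=; rewrite h'h.
  apply; first by exists h.
  move=> de Kde; apply: (Km _ _ _ (HK _ Hh')); apply: Km => //; exact: HK.
split.
- move=> _ [h [s [Hh Ds ->]]]; apply: endo_comp; [exact: He|exact: De].
- by exists id, id.
- move=> _ _ [h [s [Hh Ds ->]]] [k [r [Hk Dr ->]]].
  have [k' [Hk' kk' k'k]] := Hv _ Hk.
  exists (h \o k), ((k' \o s \o k) \o r); split; first exact: Hm.
    by apply: Dm => //; apply: conj.
  by apply/funext => x /=; rewrite k'k.
- move=> _ [h [s [Hh Ds ->]]].
  have [h' [Hh' hh' h'h]] := Hv _ Hh; have [s' [Ds' ss' s's]] := Dv _ Ds.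
  exists (s' \o h'); split.
  + exists h', (h \o s' \o h'); split=> //; first exact: conj.
    by apply/funext => x /=; rewrite hh'.
  + by move=> x /=; rewrite hh' ss'.
  + by move=> x /=; rewrite s's h'h.
Qed.

Lemma derived_tau_closed K : subgroup aI K -> tau_closed K ->
  tau_closed (derived K).
Proof.
move=> sK cK al [eal Hal]; have Ke := subgroup_endo sK.
apply/(derived_near uI _ Ke); split.
  by apply: cK; split=> // N oN /(Hal _ oN) [s /derived_sub Ks mN]; exists s.
move=> N1 N2 oN1 oN2 m1 m2; have [s] := Hal _ oN1 m1.
by move=> /(derived_near uI _ Ke) [_ ns] ms; exact: ns.
Qed.

(** Induction on stages: if the translate of [S] by the inverse of [si] lies in [G], translating the
    nearness of [s] and [si] puts it in the derived group of [G]. *)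
Lemma irreducible_Finf F S si : subgroup aI F -> S `<=` F -> S si ->
  (forall s r, S s -> S r -> near_in S s r) ->
  forall s si', S s -> cancel si si' -> cancel si' si -> Finf F (s \o si').
Proof.
move=> sF SF Ssi irr s si' Ss ss' s's G stG.
have [Fe F1 Fm Fv] := sF.
elim: stG s Ss => {G} [|G stG IH|C C0 stC IH] s Ss.
- apply: Fm; first exact: SF.
  have [be [Fbe sb bs]] := Fv _ (SF _ Ssi).
  suff -> : si' = be by [].
  by apply/funext => x; rewrite -{1}(bs x) ss'.
- have [Ge _ _ _] := stage_subgroup uI sF stG.
  apply/(derived_near uI _ Ge); split; first exact: IH.
  have esi' : endo si'.
    have [be [Fbe sb bs]] := Fv _ (SF _ Ssi).
    suff -> : si' = be by exact: Fe.
    by apply/funext => x; rewrite -{1}(bs x) ss'.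
  have := @near_in_translate _ _ _ uI S G _ _ id si' (endo_id aI) esi' _ _
    (irr _ _ Ss Ssi).
  have -> : id \o s \o si' = s \o si' by [].
  have -> : id \o si \o si' = id by apply/funext => x /=; rewrite s's.
  by apply; [exists si|exact: IH].
- by move=> G CG; exact: IH.
Qed.

(* A minimal tau-closed [A] with [H A = K] is irreducible, hence contained in
   one right coset of [Finf F], which is contained in [H]. *)
Lemma group_eq_of_aprod (E : set (I * I)) K F :
  icer E -> subgroup aI K -> tau_closed K -> subgroup aI F -> K `<=` F ->
  group_of E `<=` K -> Finf F `<=` group_of E ->
  K `<=` aprod (group_of E) (derived K) -> K `<=` group_of E.
Proof.
move=> iE sK cK sF KF HK FH KHD; set H := group_of E.
have [He H1 Hm Hv] := group_of_subgroup uI iE.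
have [Ke K1 Km Kv] := sK.
have [clE _ _ _ _] := iE.
have [[m0 _] _] := mI.
pose P : set (set (I -> I)) := [set S | [/\ S `<=` K, tau_closed S & K `<=` aprod H S]].
have [||A [[AK cA KHA] _ mA]] := @zorn_min _ P K.
- split=> // al Kal; exists id, al; split=> //.
- move=> C [S0 CS0] CP Ct; split.
  + by move=> al Cal; have [SK _ _] := CP _ CS0; apply: SK; exact: Cal.
  + move=> al Cal S CS; have [_ cS _] := CP _ CS; apply: cS.
    by apply: tau_closureS Cal => x; exact.
  move=> x Kx; have [x' [Kx' xx' x'x]] := Kv _ Kx.
  (* Every member of the chain meets the coset [H x]. Compactness gives an [al] in the tau-closures
     of all these intersections, hence in every member of the chain and in the coset. *)
  pose Hx := [set al | exists2 h, H h & al = h \o x].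
  have [||_ _ [A CA <-] [B CB <-]|al eal Hal] :=
    @tau_compact _ _ _ uI [set S `&` Hx | S in C].
  + by exists (S0 `&` Hx); exists S0.
  + move=> _ [S CS <-]; have [SK cS KHS] := CP _ CS; split.
      have [h [s [Hh Ss xhs]]] := KHS _ Kx.
      have [h' [Hh' hh' h'h]] := Hv _ Hh.
      exists s; split=> //; exists h' => //.
      by rewrite xhs; apply/funext => y /=; rewrite hh'.
    by move=> s [/SK /Ke].
  + have [D CD DAB] := total_dir Ct CA CB; exists (D `&` Hx); first by exists D.
    by move=> y [/DAB [Ay By] Hy].
  have alS S : C S -> S al.
    move=> CS; have [_ cS _] := CP _ CS; apply: cS.
    by apply: (tau_closureS _ (Hal (S `&` Hx) _)); [move=> y []|exists S].
  have Hax : H (al \o x').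
    split; first by apply: endo_comp => //; exact: Ke.
    have [cx _] := Ke _ Kx.
    have sub : graph_closure (S0 `&` Hx) `<=` [set z | E (x z.1, z.2)].
      apply: graph_closure_min.
        apply: (@closed_preimage _ _ (fun z : I * I => (x z.1, z.2))) => //.
        by apply: (@continuous_prod _ _ _ _ x id) => // ?; exact: cvg_id.
      by move=> _ m [_ [h [_ Hh] ->]] /=; exact: Hh.
    move=> m.
    have : tau_closure aI (S0 `&` Hx) al by apply: Hal; exists S0.
    by move=> /(graph_closure_tau (m := x' m)) /sub /=; rewrite x'x.
  have [h' [Hh' hh' h'h]] := Hv _ Hax.
  exists h', al; split=> //.
  by apply/funext => y; have /= := hh' (x y); rewrite xx' => ->.
have HAc (B : set (I -> I)) : B `<=` A -> tau_closed B -> tau_closed (aprod H B).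
  by move=> BA cB; apply: aprod_tau_closed => // b /BA /AK /Ke.
have open_out (B : set (I -> I)) al : tau_closed B -> endo al -> ~ B al ->
    exists N, [/\ open N, graph_meets al N & forall b, B b -> ~ graph_meets b N].
  move=> cB eal nB; apply: contrapT => nN; apply: nB; apply: cB; split=> // N oN mN.
  apply: contrapT => nb; apply: nN; exists N; split=> // b Bb mb.
  by apply: nb; exists b.
(* If [N1] and [N2] separated [s] from [r] in [A], each element of [A] would miss one of them, so
   [A] would be the union of the proper tau-closed parts [A_ N1] and [A_ N2]. By minimality neither
   part generates [K] together with [H]. *)
have irr s r : A s -> A r -> near_in A s r.
  move=> As Ar N1 N2 oN1 oN2 sN1 rN2; apply: contrapT => nN.
  pose A_ N := A `&` [set a | ~ graph_meets a N].
  have cA_ N : open N -> tau_closed (A_ N).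
    move=> oN al cl; split.
      by apply: cA; apply: tau_closureS cl => x [].
    by move=> mN; have [_ /(_ _ oN mN) [b [_]]] := cl.
  have out N a : open N -> A a -> graph_meets a N ->
      exists2 al, K al & ~ aprod H (A_ N) al.
    move=> oN Aa aN; apply: contrapT => nal.
    suff AA : A_ N = A by have := Aa; rewrite -AA => -[].
    apply: mA; last by move=> x [].
    split; [by move=> x [/AK]|exact: cA_|].
    by move=> al Kal; apply: contrapT => nn; apply: nal; exists al.
  have [al Kal nal] := out _ _ oN1 As sN1.
  have [be Kbe nbe] := out _ _ oN2 Ar rN2.
  have [al' [Kal' aa' a'a]] := Kv _ Kal.
  (* Modulo [H], the element [be] is a derived element [k] times [al]. So [k \o al] is also outside
     the second product, and it is near [al], which is outside the first; some [de] in [K] then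
     avoids both products, which is absurd. *)
  have [h [k [Hh Dk bk]]] := KHD _ (Km _ _ Kbe Kal').
  have Kk := derived_sub Dk.
  have nka : ~ aprod H (A_ N2) (k \o al).
    move=> [h1 [a [Hh1 Aa ka]]]; apply: nbe; exists (h \o h1), a; split=> //.
      exact: Hm.
    have -> : be = (be \o al') \o al by apply/funext => x /=; rewrite aa'.
    by rewrite bk -[(h \o k) \o al]/(h \o (k \o al)) ka.
  have [M1 [oM1 m1 n1]] := open_out _ _ (HAc (A_ N1) (@subIsetl _ _ _) (cA_ _ oN1))
    (Ke _ Kal) nal.
  have [M2 [oM2 m2 n2]] := open_out _ _ (HAc (A_ N2) (@subIsetl _ _ _) (cA_ _ oN2))
    (Ke _ (Km _ _ Kk Kal)) nka.
  have /(derived_near uI _ Ke) [_ nk] := Dk.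
  have near : near_in K (k \o al) al.
    have := @near_in_translate _ _ _ uI K K _ _ id al (endo_id aI) (Ke _ Kal) _ _ nk.
    have -> : id \o k \o al = k \o al by [].
    have -> : id \o id \o al = al by [].
    by apply; [exists al'|move=> de Kde; exact: (Km _ _ Kde Kal)].
  have [de Kde [d2 d1]] := near _ _ oM2 oM1 m2 m1.
  have [h1 [a [Hh1 Aa dea]]] := KHA _ Kde.
  have [aN1|naN1] := pselect (graph_meets a N1); last first.
    by apply: (n1 de) => //; exists h1, a.
  have [aN2|naN2] := pselect (graph_meets a N2); last first.
    by apply: (n2 de) => //; exists h1, a.
  by apply: nN; exists a.
have [h [si [Hh Asi _]]] := KHA _ K1.
have [si' [Ksi' ss' s's]] := Kv _ (AK _ Asi).
have AH s : A s -> H (s \o si').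
  move=> As; apply: FH.
  by apply: (irreducible_Finf sF (subset_trans AK KF) Asi irr).
have KHs al : K al -> H (al \o si').
  move=> /KHA [h1 [a [Hh1 Aa ->]]].
  exact: (Hm _ _ Hh1 (AH _ Aa)).
move=> al Kal.
(* Applied to the identity, [KHs] puts [si'] in [H], and its inverse [h1] cancels it. *)
have [h1 [Hh1 s1 s2]] := Hv _ (KHs _ K1).
have -> : al = (al \o si') \o h1.
  by apply/funext => x /=; have /= -> := s2 x.
by apply: Hm => //; exact: KHs.
Qed.

End Products.

(** * The almost periodic relation *)

Section ApRelation.
Context (T : monoid) (I : topologicalType) (aI : T -> I -> I).
Hypothesis uI : universal_minimal aI.
Implicit Types (al be de ga : I -> I) (N : set (I * I)).

Local Notation endo := (endo aI).
Local Notation tau_closure := (tau_closure aI).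

Let dI : compact_dynamic aI. Proof. by case: uI. Qed.
Let dII : compact_dynamic (pact aI). Proof. exact: pair_dynamic. Qed.
Let act2 : is_action (pact aI). Proof. by case: dII. Qed.
Let mI : minimal aI. Proof. by case: uI. Qed.
Let cact2 t : continuous (pact aI t). Proof. by case: act2. Qed.

Context (K G : set (I -> I)).
Hypotheses (sK : subgroup aI K) (cK : tau_closed aI K)
  (sG : subgroup aI G) (cG : tau_closed aI G)
  (DG : derived K `<=` G) (GK : G `<=` K).

Definition through N : set (I -> I) := [set al | K al /\ graph_meets al N].

Definition reaches N := exists2 ga, G ga & tau_closure (through N) ga.

(** Under the hypotheses of the section these are the pairs of the graph closure whose orbit closure
    contains the graph of an element of [G]. The formulation by neighbourhoods makes the relation
    closed, and [reaches] distributes over finite unions, which later allows a filter argument. *)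
Definition ap_rel : set (I * I) :=
  [set z | graph_closure K z /\ forall N, open N -> N z -> reaches N].

Let Ke : K `<=` endo. Proof. exact: subgroup_endo. Qed.
Let Ge : G `<=` endo. Proof. exact: subgroup_endo. Qed.
Let thrE N : through N `<=` endo. Proof. by move=> al [/Ke]. Qed.

Lemma reachesS N N' : through N `<=` through N' -> reaches N -> reaches N'.
Proof. by move=> NN' [ga Gga cl]; exists ga => //; exact: tau_closureS cl. Qed.

Lemma reachesU N N' : reaches (N `|` N') -> reaches N \/ reaches N'.
Proof.
move=> [ga Gga cl].
have : tau_closure (through N `|` through N') ga.
  by apply: tau_closureS cl => al [Kal [m [Nm|Nm]]]; [left|right]; split=> //; exists m.
move=> /(tau_closureU uI (@thrE N) (@thrE N')) [] c; [left|right]; by exists ga.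
Qed.

Lemma not_reaches0 : ~ reaches set0.
Proof.
move=> [ga Gga [_ /(_ _ openT)]]; have [[m _] _] := mI.
by case; [exists m|move=> s [_ [? []]]].
Qed.

Lemma through_pact t N al : endo al -> graph_meets al (pact aI t @^-1` N) ->
  graph_meets al N.
Proof. by move=> [_ ea] [m Nm]; exists (aI t m); rewrite ea. Qed.

Lemma ap_rel_closed : closed ap_rel.
Proof.
move=> z cl; split.
  by apply: (@graph_closed I K); apply: closureS cl => x [].
move=> N oN Nz; have [w [[_ Hw] Nw]] := cl _ (open_nbhs_nbhs (conj oN Nz)).
exact: Hw.
Qed.

Lemma ap_rel_invariant : invariant (pact aI) ap_rel.
Proof.
move=> t z [Kz Hz]; split; first exact: graph_closure_invariant.
move=> N oN Nz; have := Hz _ (open_preimage (cact2 (t := t)) oN) Nz.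
apply: reachesS => al [Kal mN]; split=> //.
by apply: (through_pact (t := t)) => //; exact: Ke.
Qed.

Lemma ap_rel_sub : ap_rel `<=` graph_closure K.
Proof. by move=> z []. Qed.

Lemma ap_rel_graph al m : G al -> ap_rel (m, al m).
Proof.
move=> Gal; split; first by apply: graph_closure_sub; exact: GK.
move=> N oN Nm; exists al => //; apply: sub_tau_closure => //.
by split; [exact: GK|exists m].
Qed.

(** Compactness yields a single [ga] in [G] approached by elements of [K] through every
    neighbourhood of [(m, al m)]. Then [al] and [ga] are near in [K], so they differ by an element
    of the derived group, which lies in [G]. *)
Lemma ap_rel_group al m : endo al -> ap_rel (m, al m) -> G al.
Proof.
move=> eal [Km Hm].
have Kal : K al by apply: cK; exact: (tau_closure_graph uI Ke eal Km).
pose C := [set G `&` tau_closure (through N) | N in [set N | open N /\ N (m, al m)]].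
have [||_ _ [N [oN Nm] <-] [N' [oN' Nm'] <-]|ga ega Hga] := tau_compact uI (C := C).
- exists (G `&` tau_closure (through setT)); exists setT => //; split=> //.
  exact: openT.
- move=> _ [N [oN Nm] <-]; split; last by move=> x [/Ge].
  by have [ga Gga cl] := Hm _ oN Nm; exists ga.
- exists (G `&` tau_closure (through (N `&` N'))).
    by exists (N `&` N') => //; split; [exact: openI|].
  by move=> x [Gx cl]; split; split=> //; apply: tau_closureS cl => y [Ky [n []]];
    split=> //; exists n.
have Gga : G ga.
  apply: cG; apply: (tau_closureS _ (Hga (G `&` tau_closure (through setT)) _)).
    by move=> x [].
  by exists setT => //; split=> //; exact: openT.
have near : near_in K al ga.
  move=> N2 N1 oN2 oN1 m2 m1.
  have [t N2t] := graph_orbit uI m eal oN2 m2.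
  pose N := pact aI t @^-1` N2.
  have oN : open N := open_preimage (cact2 (t := t)) oN2.
  have : tau_closure (through N) ga.
    apply: tau_closure_idem.
    apply: (tau_closureS _ (Hga (G `&` tau_closure (through N)) _)).
      by move=> x [].
    exists N => //; split=> //.
    by rewrite /N /= /pact /=; case: eal => _ <-.
  move=> [_ /(_ _ oN1 m1) [de [Kde dN] dN1]]; exists de => //; split=> //.
  exact: through_pact (Ke Kde) dN.
have [_ _ Gm Gv] := sG; have [_ _ Km' _] := sK.
have [ga' [Gga' gg' g'g]] := Gv _ Gga.
have : derived K (al \o ga').
  apply/(derived_near uI _ Ke); split; first by apply: Km' => //; exact: GK.
  have := @near_in_translate _ _ _ uI K K _ _ id ga' (endo_id aI) (Ge Gga') _ _ near.
  have -> : id \o al \o ga' = al \o ga' by [].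
  have -> : id \o ga \o ga' = id by apply/funext => x /=; rewrite g'g.
  by apply; [exists ga|move=> de Kde; apply: Km' => //; exact: GK].
move=> /DG Gal.
have -> : al = (al \o ga') \o ga by apply/funext => x /=; rewrite gg'.
exact: Gm.
Qed.

Lemma ap_rel_orbit z ga q : graph_closure K z -> G ga ->
  closure (range (fun t => pact aI t z)) (q, ga q) -> ap_rel z.
Proof.
move=> Kz Gga cl; split=> // N oN Nz; exists ga => //; split; first exact: Ge.
move=> N' oN' m'.
have [t Nt] := graph_orbit uI q (Ge Gga) oN' m'.
pose N'' := pact aI t @^-1` N'.
have oN'' : open N'' := open_preimage (cact2 (t := t)) oN'.
have N''q : N'' (q, ga q).
  by rewrite /N'' /= /pact /=; case: (Ge Gga) => _ <-.
have [_ [[s _ <-] N''s]] := cl _ (open_nbhs_nbhs (conj oN'' N''q)).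
have oM := openI oN (open_preimage (cact2 (t := s)) oN'').
have [de Kde [x [Nx Nsx]]] := (graph_closureP K z).1 Kz _ oM (conj Nz N''s).
exists de; first by split=> //; exists x.
apply: (through_pact (t := t) (Ke Kde)); apply: (through_pact (t := s) (Ke Kde)).
by exists x.
Qed.

(** For symmetry and transitivity the orbit closure of the pair or triple is replaced by graphs
    inside it. There the relation amounts to membership in the group [G] by [ap_rel_group], and
    [ap_rel_orbit] brings the conclusion back. *)
Lemma ap_rel_icer : icer aI ap_rel.
Proof.
have [_ G1 Gm Gv] := sG.
have [_ _ _ symK trK] := graph_closure_icer uI sK.
have orb_inv (z : I * I) :=
  closure_invariant (fun t => @cact2 t) (orbit_invariant act2 (z := z)).
have E1swap al be : endo al -> endo be -> (forall q, ap_rel (al q, be q)) ->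
    exists ga, G ga /\ forall q, be q = ga (al q).
  move=> ea eb ab; have [al' [ea' aa' a'a]] := endo_inverse uI ea.
  exists (be \o al'); split; last by move=> q /=; rewrite aa'.
  have [[m _] _] := mI.
  apply: (ap_rel_group (m := m)); first exact: endo_comp.
  by have := ab (al' m); rewrite a'a.
split.
- exact: ap_rel_closed.
- exact: ap_rel_invariant.
- by move=> m; exact: (ap_rel_graph m G1).
- move=> m n mn.
  have [be ebe Hbe] := pair_graph uI
    (@closed_closure _ (range (fun t => pact aI t (n, m))))
    (ex_intro _ _ (orbit_closure_refl act2)) (@orb_inv _).
  pose M := [set w : I * I | ap_rel (w.2, w.1)].
  have clM : closed M.
    apply: (@closed_preimage _ _ (fun w : I * I => (w.2, w.1))).
      by apply: continuous_pair; [exact: snd_continuous|exact: fst_continuous].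
    exact: ap_rel_closed.
  have iM : invariant (pact aI) M by move=> t w; exact: ap_rel_invariant.
  have bM q : ap_rel (be q, q).
    exact: (@orbit_closure_sub _ _ _ (n, m) M clM iM mn _ (Hbe q)).
  have [ga [Gga Hga]] := E1swap _ _ ebe (endo_id aI) bM.
  have [ga' [Gga' gg' g'g]] := Gv _ Gga.
  have [[q _] _] := mI.
  apply: (@ap_rel_orbit _ ga' q) => //.
    by apply: symK; exact: ap_rel_sub.
  have -> : ga' q = be q by rewrite {1}[q]Hga gg'.
  exact: Hbe.
- move=> m n l mn nl.
  pose a3 (t : T) (z : I * I * I) := (pact aI t z.1, aI t z.2).
  have d3 : compact_dynamic a3 by exact: pair_dynamic.
  have act3 : is_action a3 by case: d3.
  have ca3 : forall t, continuous (a3 t) by case: act3.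
  pose O := range (fun t => a3 t (m, n, l)).
  have [al [be [ea eb Hab]]] := triple_graph uI (@closed_closure _ O)
    (ex_intro _ _ (orbit_closure_refl act3))
    (fun t z Oz => closure_invariant ca3 (orbit_invariant act3) (t := t) Oz).
  have pull (f : I * I * I -> I * I) (A : set (I * I)) : continuous f ->
      (forall t z, f (a3 t z) = pact aI t (f z)) -> closed A ->
      invariant (pact aI) A -> A (f (m, n, l)) -> forall q, A (f (q, al q, be q)).
    move=> cf ef clA iA Af q.
    have clf : closed (f @^-1` A) by exact: closed_preimage.
    have if_ : invariant a3 (f @^-1` A) by move=> t z /= fz; rewrite ef; exact: iA.
    exact: (orbit_closure_sub clf if_ Af (Hab q)).
  have c11 : continuous (fun z : I * I * I => z.1.1) :=
    continuous_compose (@fst_continuous _ _) (@fst_continuous _ _).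
  have c12 : continuous (fun z : I * I * I => z.1.2) :=
    continuous_compose (@fst_continuous _ _) (@snd_continuous _ _).
  have c2 : continuous (fun z : I * I * I => z.2) := @snd_continuous _ _.
  have G_al q : ap_rel (q, al q).
    exact: (pull (fun z => (z.1.1, z.1.2)) _ (continuous_pair c11 c12) _
      ap_rel_closed ap_rel_invariant).
  have G_be q : ap_rel (al q, be q).
    exact: (pull (fun z => (z.1.2, z.2)) _ (continuous_pair c12 c2) _
      ap_rel_closed ap_rel_invariant).
  have [[q _] _] := mI.
  have Gal : G al := ap_rel_group ea (G_al q).
  have [ga [Gga Hga]] := E1swap _ _ ea eb G_be.
  apply: (@ap_rel_orbit _ (ga \o al) q); [|exact: Gm|].
    by apply: trK (ap_rel_sub mn) (ap_rel_sub nl).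
  rewrite /= -Hga.
  apply: (pull (fun z => (z.1.1, z.2)) (closure (range (fun t => pact aI t (m, l))))
    (continuous_pair c11 c2)) => //; first exact: closed_closure.
  exact: orbit_closure_refl.
Qed.

End ApRelation.

(** * Quotients by closed equivalence relations *)

(** Points are the classes themselves, as sets, so the type exists for every [E]; being an
    equivalence relation is asked only in the lemmas that need it. *)
Definition quot (I : topologicalType) (E : set (I * I)) : Type :=
  {A : set I | exists m, A = [set n | E (m, n)]}.

Definition qpi (I : topologicalType) (E : set (I * I)) (m : I) : quot E :=
  exist _ [set n | E (m, n)] (ex_intro _ m erefl).

HB.instance Definition _ (I : topologicalType) (E : set (I * I)) :=
  gen_eqMixin (quot E).
HB.instance Definition _ (I : topologicalType) (E : set (I * I)) :=
  gen_choiceMixin (quot E).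

Section QuotTopology.
Context (I : topologicalType) (E : set (I * I)).

Definition qopen : set_system (quot E) := [set A | open (@qpi I E @^-1` A)].

Lemma qopenT : qopen setT.
Proof. exact: openT. Qed.

Lemma qopenI : setI_closed qopen.
Proof. by move=> A B oA oB; rewrite /qopen /= preimage_setI; exact: openI. Qed.

Lemma qopen_bigU (J : Type) (f : J -> set (quot E)) :
  (forall i, qopen (f i)) -> qopen (\bigcup_i f i).
Proof.
move=> of_; rewrite /qopen /= preimage_bigcup.
by apply: bigcup_open => i _; exact: of_.
Qed.

HB.instance Definition _ :=
  isOpenTopological.Build (quot E) qopenT qopenI qopen_bigU.

End QuotTopology.

Section Quotient.
Context (I : topologicalType) (E : set (I * I)).
Local Notation p := (@qpi I E).

Definition qrep (x : quot E) : I := projT1 (cid (svalP x)).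

Definition qlift (W : Type) (f : I -> W) (x : quot E) : W := f (qrep x).

Lemma qrepK x : p (qrep x) = x.
Proof.
rewrite /qrep; case: cid => m /= xm; case: x xm => A PA /= AE.
exact: eq_exist.
Qed.

Lemma qpi_continuous : continuous p.
Proof. by apply/continuousP. Qed.

Lemma qlift_comp_continuous (W : topologicalType) (f : quot E -> W) :
  continuous (f \o p) -> continuous f.
Proof. by move=> /continuousP cf; apply/continuousP => A /cf. Qed.

Lemma quot_compact : compact [set: I] -> compact [set: quot E].
Proof.
move=> cI.
have -> : [set: quot E] = p @` setT.
  by apply/seteqP; split=> // x _; exists (qrep x) => //; exact: qrepK.
by apply: continuous_compact => //; apply: continuous_subspaceT; exact: qpi_continuous.
Qed.

Hypotheses (rE : forall m, E (m, m)) (sE : forall m n, E (m, n) -> E (n, m))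
  (tE : forall m n l, E (m, n) -> E (n, l) -> E (m, l)).

Lemma qpi_eqP m n : p m = p n <-> E (m, n).
Proof.
split=> [/(congr1 sval) /= mn|Emn].
  have : [set l | E (n, l)] n by exact: rE.
  by rewrite -mn.
apply: eq_exist; apply/seteqP; split=> l /=; last exact: tE.
by apply: tE; exact: sE.
Qed.

Lemma qrep_rel m : E (m, qrep (p m)).
Proof. by apply/qpi_eqP; rewrite qrepK. Qed.

Lemma qliftE (W : Type) (f : I -> W) m :
  (forall a b, E (a, b) -> f a = f b) -> qlift f (p m) = f m.
Proof. by move=> fE; apply/esym/fE; exact: qrep_rel. Qed.

Lemma qlift_continuous (W : topologicalType) (f : I -> W) :
  (forall a b, E (a, b) -> f a = f b) -> continuous f -> continuous (qlift f).
Proof.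
move=> fE cf; apply: qlift_comp_continuous.
suff -> : qlift f \o p = f by [].
by apply/funext => m; exact: qliftE.
Qed.

Lemma quot_hausdorff : compact [set: I] -> hausdorff_space I -> closed E ->
  hausdorff_space (quot E).
Proof.
move=> cI hI clE x y clxy; rewrite -(qrepK x) -(qrepK y); apply/qpi_eqP.
set m := qrep x; set n := qrep y; apply: contrapT => nmn.
have c2 : compact [set: I * I] by rewrite -setXTT; exact: compact_setX.
have sat_closed (A : set I) : closed A -> closed (snd @` (E `&` (fst @^-1` A))).
  move=> clA; apply: compact_closed => //; apply: continuous_compact.
    by apply: continuous_subspaceT; exact: snd_continuous.
  apply: (subclosed_compact _ c2 (@subsetT _ _)).
  apply: closedI => //; exact: closed_preimage (@fst_continuous _ _) clA.
(* The saturation of a closed set is closed, so the union of the classes contained in an open set is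
   open. Normality of [I] then separates two disjoint closed classes by saturated open sets. *)
have core_open (W : set I) l : open W -> [set k | E (l, k)] `<=` W ->
    exists O : set (quot E), [/\ open O, O (p l) & forall k, O (p k) -> W k].
  move=> oW lW; exists [set z | forall k, p k = z -> W k]; split.
  - have := closed_openC (sat_closed _ (open_closedC oW)).
    rewrite /open /= /qopen /=; congr open; apply/seteqP; split=> k /=.
      move=> H k' /qpi_eqP kk'; apply: contrapT => nW; apply: H.
      by exists (k', k).
    by move=> H [[k' k''] [/= kk nW] kE]; apply: nW; apply: H; apply/qpi_eqP; rewrite -kE.
  - by move=> k /qpi_eqP kl; apply: lW; exact: sE.
  - by move=> k; apply.
have clc l : closed [set k | E (l, k)].
  apply: (@closed_preimage _ _ (fun k => (l, k))) => //.
  apply: (@continuous_pair _ _ _ (fun=> l) id) => k; last exact: cvg_id.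
  exact: cvg_cst.
pose A := [set k | E (m, k)]; pose B := [set k | E (n, k)].
have nB : set_nbhs A (~` B).
  apply/set_nbhsP; exists (~` B); split=> //; first exact: closed_openC (clc n).
  by move=> k Ak Bk; apply: nmn; apply: tE Ak _; exact: sE.
have [V nV VB] := compact_normal hI cI (clc m) nB.
have [W [oW AW WV]] := (set_nbhsP _ _).1 nV.
have [O1 [oO1 O1m O1W]] := core_open _ _ oW AW.
have oV : open (~` closure V) by exact: closed_openC (@closed_closure _ V).
have [|O2 [oO2 O2n O2V]] := core_open _ n oV.
  by move=> k Bk Vk; exact: (VB _ Vk).
rewrite /m qrepK in O1m; rewrite /n qrepK in O2n.
have [z [O1z O2z]] := clxy _ _ (open_nbhs_nbhs (conj oO1 O1m))
  (open_nbhs_nbhs (conj oO2 O2n)).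
rewrite -(qrepK z) in O1z O2z.
by apply: (O2V _ O2z); apply: subset_closure; apply: WV; exact: O1W.
Qed.

End Quotient.

(** * Quotient dynamics *)

Section QuotDynamics.
Context (T : monoid) (I : topologicalType) (aI : T -> I -> I).
Hypothesis uI : universal_minimal aI.
Implicit Types (E : set (I * I)).

Local Notation endo := (endo aI).
Local Notation icer := (icer aI).
Local Notation group_of := (group_of aI).

Let dI : compact_dynamic aI. Proof. by case: uI. Qed.
Let cI : compact [set: I]. Proof. by case: dI. Qed.
Let hI : hausdorff_space I. Proof. by case: dI. Qed.
Let dII : compact_dynamic (pact aI). Proof. exact: pair_dynamic. Qed.
Let c2I : compact [set: I * I]. Proof. by case: dII. Qed.
Let act : is_action aI. Proof. by case: dI. Qed.
Let act2 : is_action (pact aI). Proof. by case: dII. Qed.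
Let mI : minimal aI. Proof. by case: uI. Qed.
Let cact2 t : continuous (pact aI t). Proof. by case: act2. Qed.

Definition qact E (t : T) : quot E -> quot E := qlift (fun m => qpi E (aI t m)).

Lemma icer_qpiP E m n : icer E -> qpi E m = qpi E n <-> E (m, n).
Proof. by move=> [_ _ rE sE tE]; exact: qpi_eqP. Qed.

Lemma icer_qliftE E (W : Type) (f : I -> W) m : icer E ->
  (forall a b, E (a, b) -> f a = f b) -> @qlift I E W f (qpi E m) = f m.
Proof. by move=> [_ _ rE sE tE]; exact: qliftE. Qed.

Lemma qactE E t m : icer E -> qact (E := E) t (qpi E m) = qpi E (aI t m).
Proof.
move=> iE; apply: icer_qliftE => // a b ab; apply/(icer_qpiP _ _ iE).
by have [_ /(_ t _ ab)] := iE.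
Qed.

Lemma quot_dynamic E : icer E -> compact_dynamic (@qact E).
Proof.
move=> iE; have [clE invE rE sE tE] := iE; have [ca a1 am] := act.
split; [exact: quot_compact|exact: quot_hausdorff|split].
- move=> t; apply: qlift_continuous => //.
    by move=> a b ab; apply/qpi_eqP => //; exact: (invE t _ ab).
  exact: continuous_compose (ca t) (@qpi_continuous _ _).
- by move=> x; rewrite -(qrepK x) qactE // a1.
- by move=> s t x; rewrite -(qrepK x) !qactE // am.
Qed.

Lemma qpi_extension E : icer E -> extension aI (@qact E) (qpi E).
Proof.
move=> iE; split; first exact: qpi_continuous.
  by move=> t m; rewrite qactE.
by move=> y; exists (qrep y); exact: qrepK.
Qed.

Lemma quot_minimal E : icer E -> minimal (@qact E).
Proof.
move=> iE; have [[m _] mm] := mI; split; first by exists (qpi E m).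
move=> A clA [x Ax] iA.
have AT : qpi E @^-1` A = setT.
  apply: mm; first exact: closed_preimage (@qpi_continuous _ _) clA.
    by exists (qrep x); rewrite /= qrepK.
  by move=> t n /= An; rewrite -qactE //; exact: iA.
apply/seteqP; split=> // y _; rewrite -(qrepK y).
by have : (qpi E @^-1` A) (qrep y) by rewrite AT.
Qed.

Lemma qlift_extension E (W : topologicalType) (aW : T -> W -> W) (f : I -> W) :
  icer E -> (forall a b, E (a, b) -> f a = f b) -> extension aI aW f ->
  extension (@qact E) aW (qlift f).
Proof.
move=> iE fE [cf ef sf]; split.
- by have [_ _ rE sE tE] := iE; exact: qlift_continuous.
- by move=> t x; rewrite -(qrepK x) qactE // !icer_qliftE.
- by move=> y; have [m <-] := sf y; exists (qpi E m); rewrite icer_qliftE.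
Qed.

Lemma qlift_qpi_extension E E' : icer E -> icer E' -> E `<=` E' ->
  extension (@qact E) (@qact E') (qlift (qpi E')).
Proof.
move=> iE iE' EE'; apply: qlift_extension => //; last exact: qpi_extension.
by move=> a b /EE' ab; apply/icer_qpiP.
Qed.

Lemma pair_qpi_continuous E :
  continuous (fun z : I * I => (qpi E z.1, qpi E z.2)).
Proof. by apply: continuous_prod; exact: qpi_continuous. Qed.

(** The orbit closure of a pair in [R] contains the graph of an automorphism. It belongs to the
    group of [R], hence to that of [E], so the quotient sends its graph to the diagonal. *)
Lemma quot_proximal E (R : set (I * I)) (W : topologicalType) (f : quot E -> W) :
  icer E -> closed R -> invariant (pact aI) R ->
  (forall m n, f (qpi E m) = f (qpi E n) -> R (m, n)) ->
  group_of R `<=` group_of E -> proximal_ext (@qact E) f.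
Proof.
move=> iE clR iR fR RE [x y]; rewrite -(qrepK x) -(qrepK y).
set m := qrep x; set n := qrep y => /fR Rmn.
have caO := closure_invariant (fun t => @cact2 t) (orbit_invariant act2 (z := (m, n))).
have [al eal Hal] := pair_graph uI
  (@closed_closure _ (range (fun t => pact aI t (m, n))))
  (ex_intro _ _ (orbit_closure_refl act2)) caO.
have [[q _] _] := mI.
have [_ Eal] : group_of E al.
  apply: RE; split=> // k; exact: (orbit_closure_sub clR iR Rmn (Hal k)).
exists (qpi E q, qpi E (al q)); split; last by apply/icer_qpiP.
move=> B nB.
have [_ [[t _ <-] /= Bt]] := Hal q _ (pair_qpi_continuous (x := (q, al q)) nB).
exists (qpi E (aI t m), qpi E (aI t n)); split=> //.
by exists t => //; rewrite /pact /= !qactE.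
Qed.

Section Ap.
Context (K G : set (I -> I)).
Hypotheses (sK : subgroup aI K) (cK : tau_closed aI K)
  (sG : subgroup aI G) (cG : tau_closed aI G)
  (DG : derived K `<=` G) (GK : G `<=` K).

Local Notation E1 := (ap_rel aI K G).
Let iE1 : icer E1. Proof. exact: ap_rel_icer. Qed.
Let iL : icer (graph_closure K). Proof. exact: graph_closure_icer. Qed.

Lemma reaches_Tset (W : set (I * I)) : open W ->
  closure (Tset aI (W `&` graph_closure K)) `&` E1 !=set0 -> reaches aI K G W.
Proof.
move=> oW ne.
have Ke := subgroup_endo sK.
have [clE1 invE1 _ _ _] := iE1.
set TA := Tset aI _ in ne.
have iTA : invariant (pact aI) TA.
  move=> t _ [s _ [z Az <-]]; exists (mmul t s) => //; exists z => //.
  by have [_ _ ->] := act2.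
have [|ga ega Hga] := pair_graph uI (closedI (@closed_closure _ TA) clE1) ne.
  move=> t z [z1 z2]; split; last exact: invE1.
  exact: closure_invariant.
have [[q _] _] := mI.
have [clq E1q] := Hga q.
have Gga : G ga := ap_rel_group uI sK cK sG cG DG GK ega E1q.
exists ga => //; split=> // N' oN' m'.
have [t Nt] := graph_orbit uI q ega oN' m'.
have oN'' : open (pact aI t @^-1` N') := open_preimage (cact2 (t := t)) oN'.
have N''q : (pact aI t @^-1` N') (q, ga q).
  by rewrite /= /pact /=; case: ega => _ <-.
have [_ [[s _ [z [Wz Kz] <-]] N''s]] := clq _ (open_nbhs_nbhs (conj oN'' N''q)).
have oM := openI oW (open_preimage (cact2 (t := s)) oN'').
have [de Kde [x [Wx Nsx]]] := (graph_closureP K z).1 Kz _ oM (conj Wz N''s).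
exists de; first by split=> //; exists x.
apply: (through_pact (t := t) (Ke _ Kde)).
by apply: (through_pact (t := s) (Ke _ Kde)); exists x.
Qed.

(** A regionally proximal pair of the quotient is lifted to a pair [(m, n)] all of whose
    neighbourhoods reach [G]. Such a pair lies in the relation, so the two points of the quotient
    coincide. *)
Lemma ap_rel_ap_ext :
  ap_ext (@qact E1) (qlift (qpi (graph_closure K)) : quot E1 -> _).
Proof.
set psi := qlift _; move=> [x [x' [_ xx' RP]]].
have psiE m n : psi (qpi E1 m) = psi (qpi E1 n) <-> graph_closure K (m, n).
  rewrite /psi !icer_qliftE //; first exact: icer_qpiP.
  - by move=> a b /ap_rel_sub ab; apply/icer_qpiP.
  - by move=> a b /ap_rel_sub ab; apply/icer_qpiP.
have hQ : hausdorff_space (quot E1) by case: (quot_dynamic iE1).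
have dQQ := pair_dynamic (quot_dynamic iE1) (quot_dynamic iE1).
pose p2 (z : I * I) := (qpi E1 z.1, qpi E1 z.2).
have cp2 : continuous p2 := @pair_qpi_continuous E1.
have claimA U V : open U -> open V -> U x -> V x' ->
    reaches aI K G (p2 @^-1` (U `*` V)).
  move=> oU oV Ux Vx'.
  have oW : open (p2 @^-1` (U `*` V)).
    by apply: open_preimage => //; exact: open_rectangle.
  apply: reaches_Tset => //.
  set A := _ `&` graph_closure K.
  have [[w w'] [clw /= ww']] := RP U V
    (open_nbhs_nbhs (conj oU Ux)) (open_nbhs_nbhs (conj oV Vx')).
  have clI : closed (p2 @` closure (Tset aI A)).
    apply: compact_closed; first by case: dQQ.
    apply: continuous_compact; first exact: continuous_subspaceT.
    exact: subclosed_compact (@closed_closure _ _) c2I (@subsetT _ _).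
  have [[a b] clab [/= aw bw]] : (p2 @` closure (Tset aI A)) (w, w').
    apply: clI; apply: closureS clw => _ [t _ [[y y'] [[/= Uy Vy'] Ryy'] <-]].
    exists (aI t (qrep y), aI t (qrep y')); last first.
      by rewrite /p2 /= -!qactE // !qrepK.
    apply: subset_closure; exists t => //; exists (qrep y, qrep y') => //.
    split; first by rewrite /= /p2 /= !qrepK.
    by apply/psiE; rewrite !qrepK.
  exists (a, b); split=> //; apply/icer_qpiP => //.
  by rewrite aw bw.
(* The sets that do not reach [G] form an ideal by [reachesU]; [F] is the filter of sets containing,
   up to this ideal, the preimage of a neighbourhood of [(x, x')]. Any cluster point of [F] is the
   wanted lift. *)
pose F : set_system (I * I) := [set A | exists U V, [/\ open U, open V, U x, V x' &
  ~ reaches aI K G ((p2 @^-1` (U `*` V)) `\` A)]].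
have rS (N N' : set (I * I)) : N `<=` N' -> reaches aI K G N -> reaches aI K G N'.
  move=> NN'; apply: reachesS => al [Kal [m Nm]]; split=> //; exists m; exact: NN'.
have FF : ProperFilter F.
  split.
    move=> [U [V [oU oV Ux Vx' nr]]]; apply: nr; rewrite setD0; exact: claimA.
  split.
  - exists setT, setT; split=> //; try exact: openT.
    by rewrite setDT; exact: not_reaches0.
  - move=> A B [U [V [oU oV Ux Vx' nA]]] [U' [V' [oU' oV' U'x V'x' nB]]].
    exists (U `&` U'), (V `&` V'); split=> //; try exact: openI.
    move=> r.
    have /(@rS _ (((p2 @^-1` (U `*` V)) `\` A) `|` ((p2 @^-1` (U' `*` V')) `\` B)))
      : reaches aI K G ((p2 @^-1` ((U `&` U') `*` (V `&` V'))) `\` (A `&` B)) by [].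
    case/(_ _)/reachesU => //.
    move=> z [[/= [Uz U'z] [Vz V'z]] nAB].
    have [Az|nAz] := pselect (A z); last by left.
    by right; split=> // Bz; exact: nAB.
  - move=> A B AB [U [V [oU oV Ux Vx' nA]]]; exists U, V; split=> //.
    by move=> /(rS _ _ (setDS AB)).
have [[m n] [_ clmn]] := c2I FF filterT.
have rN (N : set (I * I)) : open N -> N (m, n) -> reaches aI K G N.
  move=> oN Nmn; apply: contrapT => nr.
  have FN : F (~` N).
    exists setT, setT; split=> //; try exact: openT.
    by move=> r; apply: nr; apply: rS r => z [_ /contrapT].
  by have [z []] := clmn _ _ FN (open_nbhs_nbhs (conj oN Nmn)).
have mn : E1 (m, n).
  split=> //; apply: contrapT => nK.
  have oN := closed_openC (@graph_closed I K).
  apply: (@not_reaches0 _ _ _ uI K G); apply: reachesS (rN _ oN nK).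
  by move=> al [Kal [k nk]]; case: nk; exact: graph_closure_sub.
have lim (y : quot E1) (k : I) (f : I * I -> I) : continuous f -> f (m, n) = k ->
    (forall U, open U -> U y -> F ((qpi E1 \o f) @^-1` U)) -> y = qpi E1 k.
  move=> cf fk HF; apply: hQ => A B; rewrite nbhsE => -[U [oU Uy] UA] nB.
  have nB' : nbhs (m, n) ((qpi E1 \o f) @^-1` B).
    apply: (continuous_compose cf (@qpi_continuous _ _)); by rewrite /= fk.
  have [z [/= Uz Bz]] := clmn _ _ (HF _ oU Uy) nB'.
  by exists (qpi E1 (f z)); split=> //; exact: UA.
apply: xx'; rewrite (lim x m fst (@fst_continuous _ _)) //; last first.
  move=> U oU Ux; exists U, setT; split=> //; first exact: openT.
  move=> /(rS _ set0); case/(_ _)/not_reaches0 => //.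
  by move=> z [[/= Uz _] nU]; case: nU.
rewrite (lim x' n snd (@snd_continuous _ _)) //; first exact/icer_qpiP.
move=> V oV Vx'; exists setT, V; split=> //; first exact: openT.
move=> /(rS _ set0); case/(_ _)/not_reaches0 => //.
by move=> z [[/= _ Vz] nV]; case: nV.
Qed.

End Ap.

Lemma tower_step (EH R E : set (I * I)) :
  icer EH -> icer R -> Finf (group_of R) `<=` group_of EH ->
  icer E -> graph_closure (group_of EH) `<=` E -> E `<=` R ->
  E <> graph_closure (group_of EH) ->
  exists E1, [/\ icer E1, graph_closure (group_of EH) `<=` E1, E1 `<=` E, E1 <> E &
    proximal_ext (@qact E1) (qlift (qpi E) : quot E1 -> quot E) \/
    ap_ext (@qact E1) (qlift (qpi E) : quot E1 -> quot E)].
Proof.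
move=> iH iR FH iE HE ER nEH.
set H := group_of EH in FH HE nEH *; pose K := group_of E.
have [clE invE _ _ _] := iE.
have sH : subgroup aI H := group_of_subgroup uI iH.
have sK : subgroup aI K := group_of_subgroup uI iE.
have cK : tau_closed aI K := @group_of_tau_closed _ _ aI E clE.
have HK : H `<=` K.
  move=> h Hh; split; first by case: Hh.
  by move=> m; apply: HE; exact: graph_closure_sub.
have iL := graph_closure_icer uI sK.
have LE : graph_closure K `<=` E := graph_closure_group_of clE.
have [LEq|LneE] := pselect (graph_closure K = E); last first.
  exists (graph_closure K); split=> //; first exact: graph_closureS.
  left; apply: (quot_proximal (R := E)) => //.
    have eqE a b : graph_closure K (a, b) -> qpi E a = qpi E b.
      by move=> /LE ab; exact/icer_qpiP.
    by move=> m n; rewrite !icer_qliftE // => /(icer_qpiP _ _ iE).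
  by rewrite (group_of_graph_closure uI sK cK).
pose G := aprod H (derived K).
have Ke := subgroup_endo sK.
have [_ K1 Km _] := sK; have [_ H1 _ _] := sH.
have [_ D1 _ _] := derived_subgroup uI sK.
have sG : subgroup aI G by exact: aprod_subgroup.
have cG : tau_closed aI G.
  apply: (aprod_tau_closed uI iH) => [al /derived_sub /Ke //|].
  exact: derived_tau_closed.
have DG : derived K `<=` G by move=> al Dal; exists id, al.
have GK : G `<=` K.
  by move=> _ [h [s [Hh /derived_sub Ks ->]]]; apply: Km => //; exact: HK.
have KF : K `<=` group_of R.
  by move=> al [ea Ea]; split=> // m; apply: ER; exact: Ea.
have nKG : ~ K `<=` G.
  move=> KG; apply: nEH; rewrite -LEq.
  have KH := group_eq_of_aprod uI iH sK cK (group_of_subgroup uI iR) KF HK FH KG.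
  by congr graph_closure; apply/seteqP.
rewrite -LEq; exists (ap_rel aI K G); split.
- exact: ap_rel_icer.
- apply: graph_closure_min; first exact: ap_rel_closed.
  move=> h m Hh; apply: ap_rel_graph => //; by exists h, id.
- exact: ap_rel_sub.
- move=> E1L; apply: nKG => al Kal; have [[m _] _] := mI.
  apply: (ap_rel_group uI sK cK sG cG DG GK (m := m)); first exact: Ke.
  by rewrite E1L; exact: graph_closure_sub.
- right; exact: ap_rel_ap_ext.
Qed.

End QuotDynamics.

(** * PI-towers *)

Section Zermelo.
Context (U : Type) (E0 : set U) (f : set U -> set U).
Hypothesis fS : forall E, f E `<=` E.

(** The iterates of [f] from [E0], with intersections at limits. Reverse inclusion well-orders them
    and serves as the ordinal indexing a tower. *)
Inductive ztower : set U -> Prop :=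
  | ztower_base : ztower E0
  | ztower_succ E : ztower E -> ztower (f E)
  | ztower_lim (S : set (set U)) :
      S !=set0 -> (forall E, S E -> ztower E) -> ztower (\bigcap_(E in S) E).

Lemma ztower_sub E : ztower E -> E `<=` E0.
Proof.
elim=> [//|{}E _ IH|S [G SG] _ IH]; first exact: subset_trans (@fS E) IH.
by move=> x Sx; apply: (IH _ SG); exact: Sx.
Qed.

Let good c := forall x, ztower x -> c `<=` x -> c <> x -> c `<=` f x.

Let good_cmp c : ztower c -> good c -> forall x, ztower x -> c `<=` x \/ x `<=` f c.
Proof.
move=> tc gc x; elim=> [|y ty [cy|yc]|S S0 tS IH].
- by left; exact: ztower_sub.
- have [<-|ne] := pselect (c = y); [by right|left; exact: gc].
- by right; apply: subset_trans yc; exact: fS.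
have [all|] := pselect (forall s, S s -> c `<=` s).
  by left=> z cz s Ss; exact: (all _ Ss).
move=> /existsNP [s /not_implyP [Ss ncs]].
by right=> z Sz; case: (IH _ Ss) => // sf; apply: sf; exact: Sz.
Qed.

Let ztower_good c : ztower c -> good c.
Proof.
elim=> {c} [|d td gd|S S0 tS IH] x tx cx ne.
- by case: ne; apply/seteqP; split=> //; exact: ztower_sub.
- case: (good_cmp td gd tx) => [dx|xd]; last by case: ne; exact/seteqP.
  have [<-//|nd] := pselect (d = x).
  exact: subset_trans (@fS d) (gd _ tx dx nd).
have [s Ss sx] : exists2 s, S s & s `<=` x.
  apply: contrapT => nS; apply: ne; apply/seteqP; split=> // z xz s Ss.
  case: (good_cmp (tS _ Ss) (IH _ Ss) tx) => [sx|xs].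
    by case: nS; exists s.
  by apply: fS; exact: xs.
have [sE|ns] := pselect (s = x); last first.
  by move=> z Sz; apply: (IH _ Ss _ tx sx ns); exact: Sz.
have gx : good x by rewrite -sE; exact: IH.
have [xS|//] := good_cmp tx gx (ztower_lim S0 tS).
by case: ne; exact/seteqP.
Qed.

(** Zermelo's dichotomy: no member lies strictly between [c] and [f c]. Totality, well-foundedness
    and the description of successors all come from it. *)
Lemma ztower_cmp c x : ztower c -> ztower x -> c `<=` x \/ x `<=` f c.
Proof. by move=> tc tx; apply: good_cmp => //; exact: ztower_good. Qed.

Lemma ztower_total c x : ztower c -> ztower x -> c `<=` x \/ x `<=` c.
Proof.
move=> tc tx; have [|xf] := ztower_cmp tc tx; [by left|right].
exact: subset_trans xf (@fS c).
Qed.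

Definition zstrict (E D : set U) := [/\ ztower E, D `<=` E & D <> E].

Lemma ztower_acc E : ztower E -> Acc zstrict E.
Proof.
elim=> {E} [|E tE IH|S S0 tS IH]; constructor=> y [ty sy ne].
- by case: ne; apply/seteqP; split=> //; exact: ztower_sub.
- have [Ey|yf] := ztower_cmp tE ty; last by case: ne; exact/seteqP.
  have [<-//|nE] := pselect (E = y).
  by apply: (Acc_inv IH).
have [s Ss nys] : exists2 s, S s & ~ y `<=` s.
  apply: contrapT => nS; apply: ne; apply/seteqP; split=> // z yz s Ss.
  by apply: contrapT => nsz; apply: nS; exists s => // ys; apply: nsz; exact: ys.
have [//|sy'] := ztower_total ty (tS _ Ss).
apply: (Acc_inv (IH _ Ss)); split=> // sE; apply: nys; by rewrite sE.
Qed.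

Definition zindex := {E : set U | ztower E}.

Definition zlt (x y : zindex) := sval y `<=` sval x /\ sval y <> sval x.

Lemma zindex_inj (x y : zindex) : sval x = sval y -> x = y.
Proof. by case: x y => x tx [y ty] /= xy; exact: eq_exist. Qed.

Lemma zlt_well_order : well_order zlt.
Proof.
split.
- move=> x y z [yx nyx] [zy nzy]; split; first exact: subset_trans zy yx.
  by move=> zx; apply: nyx; apply/seteqP; split=> //; rewrite -zx.
- by move=> x [].
- move=> x y.
  have [/zindex_inj|ne] := pselect (sval x = sval y); first by constructor 1.
  have [xy|yx] := ztower_total (svalP x) (svalP y).
    by constructor 3; split.
  by constructor 2; split=> // /esym.
- suff acc E : Acc zstrict E -> forall x : zindex, sval x = E -> Acc zlt x.
    by move=> x; exact: acc (ztower_acc (svalP x)) x erefl.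
  elim=> {}E _ IH x xE; constructor=> y [xy ne].
  by apply: (IH (sval y)) => //; rewrite -xE; split=> //; exact: svalP.
Qed.

Lemma zleq_sub x y : oleq zlt x y -> sval y `<=` sval x.
Proof. by case=> [->|[]]. Qed.

Definition zbot : zindex := exist _ E0 ztower_base.

Definition zinf : set U := \bigcap_(E in ztower) E.

Lemma ztower_inf : ztower zinf.
Proof. by apply: ztower_lim => //; exists E0; exact: ztower_base. Qed.

Definition ztop : zindex := exist _ zinf ztower_inf.

Lemma zbot_leq g : oleq zlt zbot g.
Proof.
have [/zindex_inj|ne] := pselect (sval zbot = sval g); first by left.
by right; split; [exact: ztower_sub (svalP g)|move=> /esym].
Qed.

Lemma zleq_top g : oleq zlt g ztop.
Proof.
have [/zindex_inj|ne] := pselect (sval g = sval ztop); first by left.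
right; split; last by move=> /esym.
by move=> z; apply; exact: svalP.
Qed.

Lemma zinf_fix : f zinf = zinf.
Proof.
apply/seteqP; split; first exact: fS.
by move=> z; apply; exact: ztower_succ ztower_inf.
Qed.

(** If [f] moves the set of [g], the dichotomy applies. If [f] fixes it, that set is the least
    member of the tower and [g] has no successor. *)
Lemma zsuccE g g' : is_succ zlt g g' -> sval g' = f (sval g).
Proof.
move=> [[g'g ne] nb].
have [//|g'f] := ztower_cmp (svalP g) (svalP g').
  by move=> gg'; case: ne; exact/seteqP.
have [E|nfg] := pselect (f (sval g) = sval g); last first.
  apply: contrapT => nfg'.
  pose m : zindex := exist _ (f (sval g)) (ztower_succ (svalP g)).
  by apply: (nb m); split=> //; exact: fS.
have fixE D : ztower D -> sval g `<=` D.
  elim=> [|D' tD IH|S S0 tS IH]; first exact: ztower_sub (svalP g).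
    have [D'g|//] := ztower_cmp tD (svalP g).
    have -> : D' = sval g by apply/seteqP.
    by rewrite E.
  by move=> z gz s Ss; exact: (IH _ Ss).
case: ne; apply/seteqP; split=> //; apply: fixE; exact: svalP.
Qed.

Lemma zlimitE g : is_limit zlt g ->
  sval g = \bigcap_(E in [set sval l | l in [set l | zlt l g]]) E.
Proof.
move=> [[l0 l0g] lim].
set D := \bigcap_(E in _) E.
have tD : ztower D.
  apply: ztower_lim; first by exists (sval l0); exists l0.
  by move=> _ [l _ <-]; exact: svalP.
have gD : sval g `<=` D by move=> z gz _ [l [lg _] <-]; exact: lg.
apply: contrapT => ne.
pose d : zindex := exist _ D tD.
have [m [[md nmd] mg]] : exists m, zlt d m /\ zlt m g by apply: lim; split.
apply: nmd; apply/seteqP; split=> // z Dz; apply: Dz; by exists m.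
Qed.

End Zermelo.

Lemma dyn_iso_of_inj (T : monoid) (X Y : topologicalType) (aX : T -> X -> X)
    (aY : T -> Y -> Y) (f : X -> Y) :
  compact_dynamic aX -> compact_dynamic aY -> extension aX aY f ->
  injective f -> dyn_iso aX aY f.
Proof.
move=> [cX _ _] [_ hY _] ext inj; have [cf ef sf] := ext; split=> //.
have [g fg] := choice sf; exists g.
have gf : cancel f g by move=> x; apply: inj; rewrite fg.
split=> //; apply/continuous_closedP => A clA.
have -> : g @^-1` A = f @` A.
  apply/seteqP; split=> [y Ay|_ [x Ax <-]]; last by rewrite /= gf.
  by exists (g y).
apply: compact_closed => //; apply: continuous_compact.
  exact: continuous_subspaceT.
exact: subclosed_compact clA cX (@subsetT _ _).
Qed.

Section PITower.
Context (T : monoid) (X Y I : topologicalType) (aX : T -> X -> X)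
  (aY : T -> Y -> Y) (aI : T -> I -> I) (pi : X -> Y) (piX : I -> X).
Hypotheses (dX : compact_dynamic aX) (dY : compact_dynamic aY)
  (ext : extension aX aY pi) (uI : universal_minimal aI)
  (extX : extension aI aX piX).

Lemma kernel_icer (W : topologicalType) (aW : T -> W -> W) (f : I -> W) :
  compact_dynamic aW -> extension aI aW f ->
  icer aI [set z | f z.1 = f z.2].
Proof.
move=> [_ hW _] [cf ef _]; split=> //.
- apply: closed_equalizer => //.
    exact: continuous_compose (@fst_continuous _ _) cf.
  exact: continuous_compose (@snd_continuous _ _) cf.
- by move=> t [m n] /= mn; rewrite !ef mn.
- by move=> m n l /= -> ->.
Qed.

Local Notation EH := [set z : I * I | piX z.1 = piX z.2].
Local Notation R := [set z : I * I | pi (piX z.1) = pi (piX z.2)].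
Local Notation H := (group_of aI EH).
Local Notation L := (graph_closure H).

Lemma extension_comp : extension aI aY (pi \o piX).
Proof.
have [cX eX sX] := extX; have [cp ep sp] := ext; split.
- exact: continuous_compose cX cp.
- by move=> t m; rewrite /= eX ep.
- by move=> y; have [x <-] := sp y; have [m <-] := sX x; exists m.
Qed.

Let iH : icer aI EH. Proof. exact: kernel_icer dX extX. Qed.
Let iR : icer aI R. Proof. exact: kernel_icer dY extension_comp. Qed.
Let sH : subgroup aI H. Proof. exact: group_of_subgroup. Qed.
Let iL : icer aI L. Proof. exact: graph_closure_icer. Qed.
Let LH : L `<=` EH. Proof. by apply: graph_closure_group_of; case: iH. Qed.

Definition between E := [/\ icer aI E, L `<=` E & E `<=` R].

Lemma bigcap_between (S : set (set (I * I))) : S !=set0 ->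
  (forall E, S E -> between E) -> between (\bigcap_(E in S) E).
Proof.
move=> [E0 SE0] SB; split; last 1 first.
- by move=> z Sz; have [_ _ E0R] := SB _ SE0; apply: E0R; exact: Sz.
- split.
  + by apply: closed_bigI => E /SB [[]].
  + by move=> t z Sz E SE; have [[_ iE _ _ _] _ _] := SB _ SE; apply: iE; exact: Sz.
  + by move=> m E /SB [[]].
  + by move=> m n mn E SE; have [[_ _ _ sE _] _ _] := SB _ SE; apply: sE; exact: mn.
  + move=> m n l mn nl E SE; have [[_ _ _ _ tE] _ _] := SB _ SE.
    by apply: tE (mn _ SE) (nl _ SE).
- by move=> z Lz E SE; have [_ LE _] := SB _ SE; exact: LE.
Qed.

Definition good_step (E' E : set (I * I)) :=
  proximal_ext (qact aI (E := E')) (qlift (qpi E) : quot E' -> quot E) \/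
  ap_ext (qact aI (E := E')) (qlift (qpi E) : quot E' -> quot E).

Hypothesis FH : Finf (Fgrp aI pi piX) `<=` H.

Lemma Fgrp_group : Fgrp aI pi piX = group_of aI R.
Proof.
apply/seteqP; split=> al [aal Hal]; split.
- exact: aut_endo.
- by move=> m; rewrite /= Hal.
- exact: (endo_aut uI).
- by move=> m; have /= -> := Hal m.
Qed.

(** The step is made a total function on sets, the identity wherever no step is available, so that
    the descent can be run on it. *)
Lemma step_fun : exists f : set (I * I) -> set (I * I), forall E,
  f E `<=` E /\ (between E -> between (f E) /\
    (E <> L -> f E <> E /\ good_step (f E) E)).
Proof.
suff H E : exists E', E' `<=` E /\ (between E -> between E' /\
    (E <> L -> E' <> E /\ good_step E' E)).
  by have [f Hf] := choice H; exists f.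
have [[bE nE]|nbE] := pselect (between E /\ E <> L); last first.
  by exists E; split=> // bE; split=> // nE; case: nbE.
have [iE LE ER] := bE.
have FH' : Finf (group_of aI R) `<=` H by rewrite -Fgrp_group.
have [E1 [iE1 LE1 E1E nE1 g]] := tower_step uI iH iR FH' iE LE ER nE.
exists E1; split=> // _; split=> //; split=> //; exact: subset_trans E1E ER.
Qed.

Lemma PI_of_Finf : PI aX aY pi.
Proof.
have [f Hf] := step_fun.
have fS E : f E `<=` E by case: (Hf E).
have bR : between R.
  by split=> // z /LH /= ->.
have tb E : ztower R f E -> between E.
  elim=> [//|{}E _ /(Hf E).2 []//|S S0 _]; exact: bigcap_between.
(* The intersection of the tower is fixed by [f], while [f] strictly shrinks every intermediate
   relation other than [L]. *)
have topE : zinf R f = L.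
  apply: contrapT => ne.
  have [_ /(_ (tb _ (ztower_inf R f))) [_ /(_ ne) [nf _]]] := Hf (zinf R f).
  exact: nf (zinf_fix R fS).
have idx_icer (g : zindex R f) : icer aI (sval g) by have [] := tb _ (svalP g).
have idx_L (g : zindex R f) : L `<=` sval g by have [] := tb _ (svalP g).
have rel_qpi (E E' : set (I * I)) : icer aI E' -> E `<=` E' ->
    forall a b, E (a, b) -> qpi E' a = qpi E' b.
  by move=> iE' EE' a b /EE' ab; apply/(icer_qpiP _ _ iE').
exists (quot L : topologicalType), (qact aI (E := L)), (qlift piX).
have dL := quot_dynamic uI iL.
have piXL a b : L (a, b) -> piX a = piX b by move=> /LH.
split=> //.
- exact: quot_minimal.
- exact: qlift_extension.
- have [clH invH _ _ _] := iH.
  apply: (quot_proximal uI (R := EH)) => //.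
    by move=> m n; rewrite !(icer_qliftE _ iL).
  move=> al Hal; split; first by case: Hal.
  by move=> m; exact: graph_closure_sub.
exists (zindex R f), (@zlt _ R f), (zbot R f), (ztop R f); split.
- exact: zlt_well_order.
- exact: zbot_leq.
- exact: zleq_top.
exists (fun g => quot (sval g) : topologicalType),
  (fun g => qact aI (E := sval g)),
  (fun g => qlift (qpi (sval g))), (fun l m => qlift (qpi (sval l))).
have pE (g : zindex R f) k :
    (qlift (qpi (sval g)) : quot L -> _) (qpi L k) = qpi (sval g) k.
  by apply: (icer_qliftE k iL); exact: rel_qpi.
have psiE (l m : zindex R f) k : sval m `<=` sval l ->
    (qlift (qpi (sval l)) : quot (sval m) -> _) (qpi (sval m) k) = qpi (sval l) k.
  by move=> ml; apply: (icer_qliftE k (idx_icer m)); exact: rel_qpi.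
split; split.
- by move=> g; split; [exact: quot_dynamic|exact: quot_minimal].
- by move=> g; exact: qlift_qpi_extension.
- move=> l m /zleq_sub ml; split; first exact: qlift_qpi_extension.
  by move=> x; rewrite -(qrepK x) !pE psiE.
- move=> g g' sg; have E := zsuccE fS sg.
  change (good_step (sval g') (sval g)).
  have [_ /(_ (tb _ (svalP g))) [_ st]] := Hf (sval g).
  have ne : sval g <> L.
    have [[g'g ne] _] := sg => gL; apply: ne; apply/seteqP; split=> //.
    by rewrite gL; exact: idx_L.
  by rewrite E; case: (st ne).
- move=> g lg; have gE := zlimitE lg; split.
    move=> y1 y2; rewrite -(qrepK y1) -(qrepK y2) => H12.
    apply/(icer_qpiP _ _ (idx_icer g)); rewrite [X in X (_, _)]gE => _ [l lgl <-].
    apply/(icer_qpiP _ _ (idx_icer l)).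
    by have := H12 _ lgl; rewrite !psiE //; case: lgl.
  move=> z zc.
  have [[l0 l0g] _] := lg.
  have cI : compact [set: I] by case: uI => -[].
  (* A compatible family of classes is a decreasing family of nonempty closed subsets of [I]; a
     common point represents its limit. *)
  pose C := [set [set k | qpi (sval l) k = z l] | l in [set l | zlt l g]].
  have [||_ _ [l lgl <-] [l' lgl' <-]|k Ck] := compact_bigcap cI (C := C).
  + by exists [set k | qpi (sval l0) k = z l0]; exists l0.
  + move=> _ [l lgl <-]; split; last by exists (qrep (z l)); exact: qrepK.
    apply: closed_equalizer; first by case: (quot_dynamic uI (idx_icer l)).
      exact: qpi_continuous.
    by move=> k; exact: cvg_cst.
  + have cmp (x y : zindex R f) : oleq (@zlt _ R f) x y -> zlt y g ->
        [set k | qpi (sval y) k = z y] `<=` [set k | qpi (sval x) k = z x].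
      move=> xy yg k /= kz.
      by rewrite -(zc _ _ xy yg) -kz psiE //; exact: zleq_sub.
    have [_ _ tot _] := zlt_well_order R fS.
    case: (tot l l') => [ll'|ll'|ll'].
    * by rewrite ll'; exists [set k | qpi (sval l') k = z l'] => //; exists l'.
    * exists [set k | qpi (sval l') k = z l']; first by exists l'.
      by move=> k lk; split=> //; apply: (cmp _ _ _ lgl' k lk); right.
    * exists [set k | qpi (sval l) k = z l]; first by exists l.
      by move=> k lk; split=> //; apply: (cmp _ _ _ lgl k lk); right.
  exists (qpi (sval g) k) => l lgl; rewrite psiE; last by case: lgl.
  by have : [set k | qpi (sval l) k = z l] k by apply: Ck; exists l.
- exists (qlift (pi \o piX)); split.
    apply: dyn_iso_of_inj => //.
    + exact: (quot_dynamic uI iR).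
    + by apply: qlift_extension => //; exact: extension_comp.
    + move=> x y; rewrite -(qrepK x) -(qrepK y) !(icer_qliftE _ iR) // => xy.
      exact/(icer_qpiP _ _ iR).
  move=> x; rewrite -(qrepK x) pE (icer_qliftE _ iR) //=.
  by rewrite (icer_qliftE _ iL).
- apply: dyn_iso_of_inj => //.
  + exact: (quot_dynamic uI (idx_icer _)).
  + exact: qlift_qpi_extension.
  + move=> x y; rewrite -(qrepK x) -(qrepK y) !pE => /(icer_qpiP _ _ (idx_icer _)).
    by rewrite /= topE => /(icer_qpiP _ _ iL).
Qed.

End PITower.

(** * Topological transitivity and regional proximality *)

(** If no finite set of times brought every point of [I] into [W], compactness would give a point
    whose whole orbit misses [W], against minimality. One finite set thus works at every
    [aI t m]. *)
Lemma hom_ap_point (T : monoid) (I Z : topologicalType) (aI : T -> I -> I)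
    (aZ : T -> Z -> Z) (g : I -> Z) (m : I) :
  compact_dynamic aI -> minimal aI -> hom aI aZ g -> ap_point aZ (g m).
Proof.
move=> [cI _ act] mI [cg eg] U; rewrite nbhsE => -[V [oV Vm] VU].
pose W := g @^-1` V.
have oW : open W by exact: open_preimage.
have [ca a1 am] := act.
pose miss (K : set T) := \bigcap_(k in K) [set n | ~ W (aI k n)].
have [K [finK missK]] : exists K, finite_set K /\ ~ (miss K !=set0).
  apply: contrapT => nK.
  have [|||n Hn] := compact_bigcap cI (C := [set miss K | K in [set K | finite_set K]]).
  - by exists (miss set0); exists set0 => //; exact: finite_set0.
  - move=> _ [K finK <-]; split; last first.
      by apply: contrapT => nm; apply: nK; exists K.
    apply: closed_bigI => k _; apply: open_closedC.
    exact: open_preimage (ca k) oW.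
  - move=> _ _ [K finK <-] [K' finK' <-]; exists (miss (K `|` K')).
      by exists (K `|` K') => //=; rewrite finite_setU.
    by move=> n Hn; split=> k Kk; apply: Hn; [left|right].
  have [|t Wt] := @minimal_dense_orbit _ _ _ n W act mI oW; first by exists m.
  by apply: (Hn (miss [set t])) Wt => //; exists [set t] => //; exact: finite_set1.
exists K; split=> // t; apply: contrapT => nk; apply: missK; exists (aI t m).
move=> k Kk /= Wk; apply: nk; exists k => //=.
by apply: VU; rewrite -eg am.
Qed.

(** Transitivity carries some point of [L] near [z] to a point near [(x0, x0)]. The net is indexed
    by pairs of neighbourhoods of these two points. *)
Lemma RP_in_of_transitive (T : monoid) (X : topologicalType) (a : T -> X -> X)
    (L : set (X * X)) (x0 : X) : L (x0, x0) ->
  (forall U V : set (X * X), open U -> open V ->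
     U `&` L !=set0 -> V `&` L !=set0 ->
     exists t, V `&` L `&` (pact a t @` (U `&` L)) !=set0) ->
  RP_in a L = L.
Proof.
move=> Lx0 TT; apply/seteqP; split=> [z []//|z Lz]; split=> //.
pose D := {UV : set (X * X) * set (X * X) | nbhs z UV.1 /\ nbhs (x0, x0) UV.2}.
pose le (i j : D) := (sval j).1 `<=` (sval i).1 /\ (sval j).2 `<=` (sval i).2.
pose mk U V (nU : nbhs z U) (nV : nbhs (x0, x0) V) : D := exist _ (U, V) (conj nU nV).
have key (i : D) : exists wt : (X * X) * T,
    [/\ L wt.1, (sval i).1 wt.1 & (sval i).2 (pact a wt.2 wt.1)].
  case: i => -[U V] [/= nU nV].
  have [||t [v [[Vv _] [w [Uw Lw] wE]]]] :=
    TT U° V° (@open_interior _ U) (@open_interior _ V).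
  - by exists z.
  - by exists (x0, x0).
  exists (w, t); split=> //=; first exact: interior_subset.
  by rewrite wE; exact: interior_subset.
have [s Hs] := choice key.
exists D, le, (fun i => (s i).1), (fun i => (s i).2), (x0, x0); split=> //.
- split.
  + exact: inhabits (mk setT setT filterT filterT).
  + by move=> i; split.
  + by move=> i j k [ij1 ij2] [jk1 jk2]; split; [exact: subset_trans jk1 ij1|
      exact: subset_trans jk2 ij2].
  + move=> [[U V] [nU nV]] [[U' V'] [nU' nV']].
    exists (mk _ _ (filterI nU nU') (filterI nV nV')).
    by split; split=> x [].
- by move=> i; case: (Hs i).
- move=> U nU; exists (mk U setT nU filterT) => i [Ui _]; apply: Ui.
  by case: (Hs i).
- move=> V nV; exists (mk setT V filterT nV) => i [_ Vi]; apply: Vi.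
  by case: (Hs i).
Qed.

Theorem theorem3p5 (T : monoid) (X Y I : topologicalType)
  (aX : T -> X -> X) (aY : T -> Y -> Y) (aI : T -> I -> I)
  (pi : X -> Y) (piX : I -> X) :
  compact_dynamic aX -> minimal aX ->
  compact_dynamic aY -> minimal aY ->
  extension aX aY pi -> ~ PI aX aY pi ->
  universal_minimal aI -> extension aI aX piX ->
  [/\ M_dynamic_in aX (Minf aI pi piX),
      Minf aI pi piX `<=` Rel pi,
      Delta X `<` Minf aI pi piX &
      RP_in aX (Minf aI pi piX) = Minf aI pi piX].
Proof.
move=> dX _ dY _ ext nPI uI extX.
have [cX eX sX] := extX; have [cp ep sp] := ext.
have [dI mI _] := uI.
set L := Minf aI pi piX.
pose F := Fgrp aI pi piX.
pose p2 (z : I * I) := (piX z.1, piX z.2).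
have cp2 : continuous p2 by exact: continuous_prod.
have iR := kernel_icer dY (extension_comp ext extX).
have sF : subgroup aI F.
  by rewrite /F (Fgrp_group pi piX uI); exact: group_of_subgroup.
have [Fe F1 _ _] := Finf_subgroup uI sF.
have LE z : L z <-> exists2 w, graph_closure (Finf F) w & p2 w = z by [].
have Lgraph al m : Finf F al -> L (p2 (m, al m)).
  by move=> Fal; exists (m, al m) => //; exact: graph_closure_sub.
have approx (U : set (X * X)) : open U -> U `&` L !=set0 ->
    exists2 al, Finf F al & graph_meets al (p2 @^-1` U).
  move=> oU [z [Uz [w /graph_closureP Fw wE]]].
  by apply: Fw; [exact: open_preimage|rewrite /= /p2 wE].
have p2_pact t w : pact aX t (p2 w) = p2 (pact aI t w) by rewrite /p2 /pact /= !eX.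
have TT (U V : set (X * X)) : open U -> open V ->
    U `&` L !=set0 -> V `&` L !=set0 ->
    exists t, V `&` L `&` (pact aX t @` (U `&` L)) !=set0.
  move=> oU oV UL VL.
  have [al Fal alU] := approx _ oU UL; have [be Fbe beV] := approx _ oV VL.
  have oU' := open_preimage cp2 oU; have oV' := open_preimage cp2 oV.
  (* A single graph meets both preimages, and the orbit of its point in the first one enters the
     second. *)
  have [de Fde [[m Um] dV]] := Finf_near uI sF Fal Fbe oU' oV' alU beV.
  have [t Vt] := graph_orbit uI m (Fe _ Fde) oV' dV.
  exists t, (p2 (aI t m, de (aI t m))); split.
    by split=> //; exact: Lgraph.
  exists (p2 (m, de m)); first by split=> //; exact: Lgraph.
  by rewrite p2_pact /pact /=; case: (Fe _ Fde) => _ ->.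
have LR : L `<=` Rel pi.
  move=> _ [w Fw <-].
  have [clR _ _ _ _] := iR.
  apply: (graph_closure_min clR _ Fw) => al m /(_ _ (stage_base F)) [_ H].
  by rewrite /= H.
have [[m0 _] _] := mI.
have Ldiag : Delta X `<=` L.
  move=> [x x']; rewrite /Delta /= => <-; have [m <-] := sX x; exact: (Lgraph _ m F1).
split=> //.
- split=> //.
    move=> t _ [w Fw <-]; rewrite -/(p2 w) p2_pact; exists (pact aI t w) => //.
    exact: graph_closure_invariant.
  move=> U oU UL; have [al Fal [m Um]] := approx _ oU UL.
  exists (p2 (m, al m)); first by split=> //; exact: Lgraph.
  have [ca ea] := Fe _ Fal.
  apply: (@hom_ap_point _ _ _ aI _ (fun m => p2 (m, al m))) => //; split.
    apply: (continuous_pair cX); exact: continuous_compose ca cX.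
  by move=> t n; rewrite p2_pact /pact /= ea.
(* If [L] were contained in the diagonal, each element of [Finf F] would preserve the fibres of
   [piX], and the tower would make [pi] a PI extension. *)
- split=> // LD; apply: nPI; apply: (PI_of_Finf dX dY ext uI extX).
  move=> al Fal; split; first exact: Fe.
  by move=> m; have := LD _ (Lgraph _ m Fal).
- exact: (RP_in_of_transitive (Ldiag (piX m0, piX m0) erefl) TT).
Qed.
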